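(* Let $\mathfrak{g}$ be a complex Lie algebra of dimension $\leq 4$. Then $\mathfrak{g}$ is defined over $\mathbb{R}$ if and only if $\mathfrak{g} \cong \overline{\mathfrak{g}}$ as complex Lie algebras.
   Context: A complex Lie algebra $\mathfrak{g}$ is defined over $\mathbb{R}$ if there is a real Lie algebra $\mathfrak{m}$ with $\mathfrak{g} \cong \mathfrak{m} \otimes_{\mathbb{R}} \mathbb{C}$ as complex Lie algebras. The complex conjugate Lie algebra $\overline{\mathfrak{g}}$ is the complex Lie algebra, well defined up to isomorphism, whose structure constants with respect to some basis are the complex conjugates of the structure constants of $\mathfrak{g}$ with respect to a basis of $\mathfrak{g}$. *)

(* Defs.v *)
From HB Require Import structures.
From mathcomp Require Import all_boot all_order all_algebra.
From mathcomp Require Import complex reals boolp.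
From mathcomp Require Import ssrAC.

Set Implicit Arguments.
Unset Strict Implicit.
Unset Printing Implicit Defensive.

Import GRing.Theory.

Local Open Scope ring_scope.

HB.mixin Record Lmodule_isLieAlgebra (K : fieldType) (V : Type)
    of GRing.Lmodule K V := {
  lie : V -> V -> V;
  lie_linearl : forall z : V, linear (fun x => lie x z);
  lie_linearr : forall z : V, linear (lie z);
  liexx : forall x : V, lie x x = 0;
  lie_jacobi : forall x y z : V,
    lie x (lie y z) + lie y (lie z x) + lie z (lie x y) = 0
}.

#[short(type="lieAlgType")]
HB.structure Definition LieAlgebra (K : fieldType) :=
  { V of GRing.Lmodule K V & Lmodule_isLieAlgebra K V }.

#[short(type="vectLieAlgType")]
HB.structure Definition VectLieAlgebra (K : fieldType) :=
  { V of Vector K V & Lmodule_isLieAlgebra K V }.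

Definition lie_isomorphic (K : fieldType) (g h : lieAlgType K) : Prop :=
  exists f : {linear g -> h},
    bijective f /\ forall x y : g, f (lie x y) = lie (f x) (f y).

Section LieTheory.
Variables (K : fieldType) (V : lieAlgType K).
Implicit Types (x y z : V) (a : K).

Lemma lieDl x y z : lie (x + y) z = lie x z + lie y z.
Proof. by have := lie_linearl z 1 x y; rewrite !scale1r. Qed.

Lemma lieDr x y z : lie z (x + y) = lie z x + lie z y.
Proof. by have := lie_linearr z 1 x y; rewrite !scale1r. Qed.

Lemma lie0l z : lie 0 z = 0.
Proof. by apply: (addrI (lie 0 z)); rewrite -lieDl !addr0. Qed.

Lemma lie0r z : lie z 0 = 0.
Proof. by apply: (addrI (lie z 0)); rewrite -lieDr !addr0. Qed.

Lemma lieZl a x z : lie (a *: x) z = a *: lie x z.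
Proof. by have := lie_linearl z a x 0; rewrite lie0l !addr0. Qed.

Lemma lieZr a x z : lie z (a *: x) = a *: lie z x.
Proof. by have := lie_linearr z a x 0; rewrite lie0r !addr0. Qed.

Lemma lieNl x z : lie (- x) z = - lie x z.
Proof. by rewrite -scaleN1r lieZl scaleN1r. Qed.

Lemma lieNr x z : lie z (- x) = - lie z x.
Proof. by rewrite -scaleN1r lieZr scaleN1r. Qed.

Lemma lieC x y : lie x y = - lie y x.
Proof.
have := liexx (x + y); rewrite lieDl !lieDr !liexx add0r addr0 => /eqP.
by rewrite addr_eq0 => /eqP.
Qed.

Lemma lie_suml I (r : seq I) (P : pred I) (F : I -> V) z :
  lie (\sum_(i <- r | P i) F i) z = \sum_(i <- r | P i) lie (F i) z.
Proof.
by apply: (big_morph (fun x => lie x z)) => [x y|]; [exact: lieDl|exact: lie0l].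
Qed.

Lemma lie_sumr I (r : seq I) (P : pred I) (F : I -> V) z :
  lie z (\sum_(i <- r | P i) F i) = \sum_(i <- r | P i) lie z (F i).
Proof.
by apply: (big_morph (lie z)) => [x y|]; [exact: lieDr|exact: lie0r].
Qed.

End LieTheory.

(* The complex Lie algebra m (x)_R C. As C is R-free on (1, i), its elements *)
(* are the x (x) 1 + y (x) i, encoded as the pairs (x, y); [ctens_universal], *)
(* [scale_ctens] and [lie_ctens] show that this is the tensor product.        *)
Definition complexification (R : rcfType) (m : lmodType R) : Type :=
  (m * m)%type.

Section ComplexificationModule.
Variables (R : rcfType) (m : lmodType R).

HB.instance Definition _ :=
  GRing.Zmodule.copy (complexification m) (m * m)%type.

Definition cscale (c : R[i]) (u : complexification m) : complexification m :=
  (complex.Re c *: u.1 - complex.Im c *: u.2,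
   complex.Re c *: u.2 + complex.Im c *: u.1).

Fact cscaleA a b u : cscale a (cscale b u) = cscale (a * b) u.
Proof.
case: a b u => [a1 a2] [b1 b2] [x y]; congr pair => /=;
  rewrite !(scalerBr, scalerDr, scalerA, scalerBl, scalerDl) ?opprD ?addrA.
  by rewrite [LHS](ACl (1*4*2*3)).
by rewrite [LHS](ACl (1*4*2*3)).
Qed.

Fact cscale1 : left_id 1 cscale.
Proof.
by case=> x y; congr pair; rewrite /= !scale1r scale0r ?subr0 ?addr0.
Qed.

Fact cscaleDr : right_distributive cscale +%R.
Proof.
by case=> a b [x y] [z t]; congr pair; rewrite /= !scalerDr ?opprD;
  rewrite (AC (2*2) ((1*3)*(2*4))).
Qed.

Fact cscaleDl u : {morph cscale^~ u : a b / a + b}.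
Proof.
by case: u => x y [a b] [c d]; congr pair; rewrite /= !scalerDl ?opprD;
  rewrite (AC (2*2) ((1*3)*(2*4))).
Qed.

HB.instance Definition _ :=
  GRing.Zmodule_isLmodule.Build R[i] (complexification m)
    cscaleA cscale1 cscaleDr cscaleDl.

Definition ctens (x : m) (c : R[i]) : complexification m :=
  (complex.Re c *: x, complex.Im c *: x).

Lemma scale_ctens a x c : a *: ctens x c = ctens x (a * c).
Proof.
case: a c => [a b] [c d]; congr pair;
  by rewrite /= !scalerA -?scalerBl -?scalerDl.
Qed.

Lemma ctens_universal (W : lmodType R) (b : m -> Rcomplex R -> W) :
    (forall x, linear (b x)) -> (forall c, linear (b^~ c)) ->
  exists! f : complexification m -> W,
    [/\ forall u v, f (u + v) = f u + f v,
        forall (a : R) u, f (a%:C%C *: u) = a *: f u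
      & forall x c, f (ctens x c) = b x c].
Proof.
move=> bl br.
have bDr x c d : b x (c + d) = b x c + b x d.
  by have := bl x 1 c d; rewrite !scale1r.
have bDl x y c : b (x + y) c = b x c + b y c.
  by have := br c 1 x y; rewrite !scale1r.
have b0r x : b x 0 = 0 by apply: (addrI (b x 0)); rewrite -bDr !addr0.
have b0l c : b 0 c = 0 by apply: (addrI (b 0 c)); rewrite -bDl !addr0.
have bZr a x (c : Rcomplex R) : b x (a *: c) = a *: b x c.
  by have := bl x a c 0; rewrite b0r !addr0.
have bZl a x c : b (a *: x) c = a *: b x c.
  by have := br c a x 0; rewrite b0l !addr0.
pose I := (0 +i* 1)%C : Rcomplex R.
exists (fun u => b u.1 1 + b u.2 I); split=> [|f [fD fZ ft]]; first split.
- by case=> x y [z t] /=; rewrite !bDl [LHS](AC (2*2) ((1*3)*(2*4))).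
- move=> a [x y].
  have -> : a%:C%C *: ((x, y) : complexification m) = (a *: x, a *: y).
    by congr pair; rewrite /= scale0r ?subr0 ?addr0.
  by rewrite /= !bZl scalerDr.
- move=> x [c d] /=; rewrite !bZl -!bZr -bDr; congr (b x _).
  by apply/eqP; rewrite eq_complex /= !(mulr1, mulr0, addr0, add0r) !eqxx.
apply: functional_extensionality_dep => -[x y].
rewrite -!ft -fD /=; congr (f _); congr pair => /=;
  by rewrite !(scale0r, scale1r, addr0, add0r).
Qed.

End ComplexificationModule.

Section Complexification.
Variables (R : rcfType) (m : lieAlgType R).

Definition clie (u v : complexification m) : complexification m :=
  (lie u.1 v.1 - lie u.2 v.2, lie u.1 v.2 + lie u.2 v.1).

Fact clie_linearl w : linear (clie^~ w).
Proof.
case: w => x' y' [a b] [x y] [z t]; congr pair => /=;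
  rewrite !(lieDl, lieZl, lieNl, scalerBr, scalerDr, scalerA)
    ?opprD ?opprK !addrA;
  by rewrite [LHS](ACl (1*4*5*2*3*6)).
Qed.

Fact clie_linearr w : linear (clie w).
Proof.
case: w => x' y' [a b] [x y] [z t]; congr pair => /=;
  rewrite !(lieDr, lieZr, lieNr, scalerBr, scalerDr, scalerA)
    ?opprD ?opprK !addrA;
  by rewrite [LHS](ACl (1*4*2*5*3*6)).
Qed.

Fact cliexx u : clie u u = 0.
Proof.
by case: u => x y; congr pair; rewrite /= ?liexx ?subrr // lieC addNr.
Qed.

Fact clie_jacobi x y z :
  clie x (clie y z) + clie y (clie z x) + clie z (clie x y) = 0.
Proof.
case: x y z => [x x'] [y y'] [z z'];  congr pair => /=;
  rewrite !(lieDr, lieNr) ?opprD ?opprK !addrA.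
  rewrite [LHS](ACl ((1*5*9)*(2*8*11)*(3*6*12)*(4*7*10))) /= -!opprD.
  by rewrite !lie_jacobi !subr0.
rewrite [LHS](ACl ((1*6*11)*(2*7*9)*(3*5*10)*(4*8*12))) /= -!opprD.
by rewrite !lie_jacobi subr0 !addr0.
Qed.

HB.instance Definition _ :=
  Lmodule_isLieAlgebra.Build R[i] (complexification m)
    clie_linearl clie_linearr cliexx clie_jacobi.

Lemma lie_ctens (x y : m) a b :
  lie (ctens x a) (ctens y b) = ctens (lie x y) (a * b).
Proof.
case: a b => [a b] [c d]; congr pair => /=;
  by rewrite !(lieZl, lieZr) !scalerA -?scalerBl -?scalerDl.
Qed.

End Complexification.

Definition defined_over_reals (R : rcfType) (g : lieAlgType R[i]) : Prop :=
  exists m : lieAlgType R, lie_isomorphic g (complexification m).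

Definition struct_const (K : fieldType) (g : vectLieAlgType K) n
    (e : n.-tuple g) (i j k : 'I_n) : K :=
  coord e k (lie e`_i e`_j).

(* The complex conjugate Lie algebra, on the coordinate space: its structure *)
(* constants in the standard basis are the conjugates of those of g in the    *)
(* basis [vbasis {:g}].                                                       *)
Definition conj_lie (R : rcfType) (g : vectLieAlgType R[i]) : Type :=
  'rV[R[i]]_(\dim {:g}).

Section ConjLie.
Variables (R : rcfType) (g : vectLieAlgType R[i]).

HB.instance Definition _ := Vector.copy (conj_lie g) 'rV[R[i]]_(\dim {:g}).

Definition conj_bracket (u v : conj_lie g) : conj_lie g :=
  \row_k \sum_i \sum_j
    u 0 i * v 0 j * (struct_const (vbasis {:g}) i j k)^*%C.


Let e := vbasis {:g}.

Definition conj_coord (u : conj_lie g) : g := \sum_i (u 0 i)^*%C *: e`_i.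

Definition conj_uncoord (x : g) : conj_lie g := \row_k (coord e k x)^*%C.

Fact conj_coordK : cancel conj_coord conj_uncoord.
Proof.
move=> u; apply/rowP=> k; rewrite mxE.
by rewrite coord_sum_free ?(basis_free (vbasisP _)) // conjcK.
Qed.

Fact conj_uncoordK : cancel conj_uncoord conj_coord.
Proof.
move=> x; rewrite /conj_coord [RHS](coord_vbasis (memvf x)).
by apply: eq_bigr => i _; rewrite mxE conjcK.
Qed.

Fact conj_coordZD a u v :
  conj_coord (a *: u + v) = a^*%C *: conj_coord u + conj_coord v.
Proof.
rewrite /conj_coord scaler_sumr -big_split; apply: eq_bigr => i _ /=.
by rewrite !mxE rmorphD rmorphM scalerDl scalerA.
Qed.

Fact conj_uncoordZD a x y :
  conj_uncoord (a *: x + y) = a^*%C *: conj_uncoord x + conj_uncoord y.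
Proof.
apply: (can_inj conj_coordK).
by rewrite [RHS]conj_coordZD !conj_uncoordK conjcK.
Qed.

Fact conj_bracketE u v :
  conj_bracket u v = conj_uncoord (lie (conj_coord u) (conj_coord v)).
Proof.
apply/rowP=> k; rewrite !mxE lie_suml linear_sum rmorph_sum.
apply: eq_bigr => i _; rewrite lie_sumr linear_sum rmorph_sum.
apply: eq_bigr => j _; rewrite lieZl lieZr !linearZ /= !rmorphM /= !conjcK.
by rewrite mulrA.
Qed.

Fact conj_bracket_linearl w : linear (conj_bracket^~ w).
Proof.
by move=> a u v; rewrite !conj_bracketE conj_coordZD lieDl lieZl
  conj_uncoordZD conjcK.
Qed.

Fact conj_bracket_linearr w : linear (conj_bracket w).
Proof.
by move=> a u v; rewrite !conj_bracketE conj_coordZD lieDr lieZr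
  conj_uncoordZD conjcK.
Qed.

Fact conj_coord0 : conj_coord 0 = 0.
Proof. by rewrite /conj_coord big1 // => i _; rewrite mxE conjc0 scale0r. Qed.

Fact conj_coordD u v : conj_coord (u + v) = conj_coord u + conj_coord v.
Proof. by have := conj_coordZD 1 u v; rewrite conjc1 !scale1r. Qed.

Fact conj_bracketxx u : conj_bracket u u = 0.
Proof. by rewrite conj_bracketE liexx -conj_coord0 conj_coordK. Qed.

Fact conj_bracket_jacobi u v w :
  conj_bracket u (conj_bracket v w) + conj_bracket v (conj_bracket w u) +
  conj_bracket w (conj_bracket u v) = 0.
Proof.
apply: (can_inj conj_coordK); rewrite !conj_bracketE !conj_coordD.
by rewrite !conj_uncoordK lie_jacobi conj_coord0.
Qed.

HB.instance Definition _ :=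
  Lmodule_isLieAlgebra.Build R[i] (conj_lie g)
    conj_bracket_linearl conj_bracket_linearr conj_bracketxx
    conj_bracket_jacobi.

Lemma lie_conj_delta i j :
  lie (delta_mx 0 i : conj_lie g) (delta_mx 0 j) =
    \row_k (struct_const e i j k)^*%C.
Proof.
apply/rowP=> k; rewrite !mxE (bigD1 i) //= [X in _ + X]big1 => [|i' ni].
  rewrite addr0 (bigD1 j) //= [X in _ + X]big1 => [|j' nj].
    by rewrite !mxE !eqxx !mul1r !addr0.
  by rewrite !mxE (negPf nj) mulr0 mul0r.
by apply: big1 => j' _; rewrite !mxE (negPf ni) !mul0r.
Qed.

End ConjLie.

(* Independence of the choice of bases: any h whose structure constants in    *)
(* some basis are conjugate to those of g in some basis is a model of         *)
(* [conj_lie g].                                                              *)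
Lemma conj_lie_wd (R : rcfType) (g h : vectLieAlgType R[i]) n
    (e : n.-tuple g) (f : n.-tuple h) :
    basis_of {:g} e -> basis_of {:h} f ->
    (forall i j k, struct_const f i j k = (struct_const e i j k)^*%C) ->
  lie_isomorphic h (conj_lie g).
Proof.
move=> be bf sc.
pose s (y : h) : g := \sum_i (coord f i y)^*%C *: e`_i.
pose t (x : g) : h := \sum_i (coord e i x)^*%C *: f`_i.
have tK : cancel t s.
  move=> x; rewrite [RHS](coord_basis be (memvf x)); apply: eq_bigr => i _.
  by rewrite coord_sum_free ?(basis_free bf) // conjcK.
have sK : cancel s t.
  move=> x; rewrite [RHS](coord_basis bf (memvf x)); apply: eq_bigr => i _.
  by rewrite coord_sum_free ?(basis_free be) // conjcK.
have sZD a x y : s (a *: x + y) = a^*%C *: s x + s y.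
  rewrite /s scaler_sumr -big_split; apply: eq_bigr => i _ /=.
  by rewrite linearP rmorphD rmorphM scalerDl scalerA.
have sL x y : s (lie x y) = lie (s x) (s y).
  apply: (can_inj tK); rewrite sK [LHS](coord_basis bf (memvf _)).
  apply: eq_bigr => k _; congr (_ *: _).
  rewrite [in LHS](coord_basis bf (memvf x)) [in LHS](coord_basis bf (memvf y)).
  rewrite /s !lie_suml !linear_sum /= ?rmorph_sum; apply: eq_bigr => i _.
  rewrite !lie_sumr !linear_sum ?rmorph_sum; apply: eq_bigr => j _.
  rewrite !(lieZl, lieZr) !linearZ /= !rmorphM /= !conjcK; congr (_ * (_ * _)).
  exact: sc.
pose F (y : h) : conj_lie g := conj_uncoord (s y).
have FL : linear F by move=> a x y; rewrite /F sZD conj_uncoordZD conjcK.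
pose FM := GRing.isLinear.Build R[i] h (conj_lie g) _ F FL.
pose Fl : {linear h -> conj_lie g} := HB.pack F FM.
exists Fl; split.
  exists (fun u => t (conj_coord u)) => [y|u] /=; rewrite /F.
    by rewrite conj_uncoordK sK.
  by rewrite tK conj_coordK.
move=> x y; rewrite /= /F sL [RHS]conj_bracketE.
by rewrite !conj_uncoordK.
Qed.

(* Main.v *)
(* An isomorphism of g with its conjugate is an antilinear automorphism s of g,
   and a real form is an antilinear involutive automorphism, so s has to be
   corrected into an involution. The square t = s^2 is a linear automorphism
   commuting with s. Let q = f(t), where the polynomial f has real coefficients
   modulo an annihilator of t and takes at each eigenvalue l the root of
   f(l)^2 l = 1 (if l > 0) or f(l)^2 l = -1 (otherwise) of positive real part.
   Then s0 = s q is antilinear, and eps = s0^2 is an involution with eigenspaces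
   V+ and V-. Multiplying eigenvalues shows that eps is a Z/2-grading and s0 an
   automorphism as soon as [V-, V-] lies in V+. Since s0^2 = -1 on V-, its
   dimension is even.
   If dim V- = 0, then s0 is the required involution.
   If dim V- = 2, then V- is a quaternionic line on which V+, of dimension at
   most 2, acts by commuting operators. A common eigenvector v of V+, together
   with s0 v and [v, s0 v], provides a basis with real structure constants.
   If dim V- = 4, then no subspace of odd dimension is stable under s. This
   forces g to be abelian, as otherwise dim [g, g] = 2 and g / [g, g] would be a
   plane of commuting traceless operators on the plane [g, g]. *)
Require Import Defs.
From HB Require Import structures.
From mathcomp Require Import all_boot all_order all_algebra.
From mathcomp Require Import complex reals boolp.
From mathcomp Require Import ring zify.

Set Implicit Arguments.
Unset Strict Implicit.
Unset Printing Implicit Defensive.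

Import Order.TTheory GRing.Theory Num.Theory.
Local Open Scope ring_scope.

(** * Polynomials in a linear operator *)

(** Annihilating polynomials are kept as lists of roots, so that roots can be filtered, conjugated
    and multiplied. *)
Definition root_prod (K : fieldType) (s : seq K) : {poly K} :=
  \prod_(z <- s) ('X - z%:P).

Section PolyAct.
Variables (K : fieldType) (V : lmodType K) (t : {linear V -> V}).
Implicit Types (p q : {poly K}) (x y : V) (s : seq K).

(** The value at [x] of the operator [p(t)]. *)
Definition pact p x := \sum_(i < size p) p`_i *: iter i t x.

Lemma pact_widen n p x : (size p <= n)%N ->
  pact p x = \sum_(i < n) p`_i *: iter i t x.
Proof.
move=> le_pn; rewrite /pact (big_ord_widen n (fun i => p`_i *: iter i t x)) //.
rewrite big_mkcond /=; apply: eq_bigr => i _; case: ltnP => // le_pi.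
by rewrite nth_default ?scale0r.
Qed.

Lemma pactD p q x : pact (p + q) x = pact p x + pact q x.
Proof.
pose n := maxn (size p) (size q).
rewrite (@pact_widen n (p + q)) ?size_polyD // (@pact_widen n p) ?leq_maxl //.
rewrite (@pact_widen n q) ?leq_maxr // -big_split; apply: eq_bigr => i _ /=.
by rewrite coefD scalerDl.
Qed.

Lemma pactZ c p x : pact (c *: p) x = c *: pact p x.
Proof.
rewrite (@pact_widen (size p)) ?size_scale_leq // scaler_sumr.
by apply: eq_bigr => i _; rewrite coefZ scalerA.
Qed.

Lemma pact0 x : pact 0 x = 0.
Proof. by rewrite /pact size_poly0 big_ord0. Qed.

Lemma pactN p x : pact (- p) x = - pact p x.
Proof. by rewrite -(scaleN1r p) pactZ scaleN1r. Qed.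

Lemma pactB p q x : pact (p - q) x = pact p x - pact q x.
Proof. by rewrite pactD pactN. Qed.

Lemma pactC c x : pact c%:P x = c *: x.
Proof.
by rewrite (@pact_widen 1) ?size_polyC_leq1 // big_ord1 coefC eqxx.
Qed.

Lemma pact1 x : pact 1 x = x.
Proof. by rewrite pactC scale1r. Qed.

Lemma iter_linear n : linear (iter n t).
Proof.
by elim: n => [|n IHn] a x y //=; rewrite IHn linearP.
Qed.

Lemma pact_linear p : linear (pact p).
Proof.
move=> a x y; rewrite /pact scaler_sumr -big_split; apply: eq_bigr => i _ /=.
by rewrite iter_linear scalerDr !scalerA mulrC.
Qed.

HB.instance Definition _ p := GRing.isLinear.Build K V V _ (pact p)
  (pact_linear p).

Lemma pactMX p x : pact (p * 'X) x = t (pact p x).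
Proof.
rewrite (@pact_widen (size p).+1); last first.
  by rewrite (leq_trans (size_polyMleq _ _)) // size_polyX addn2.
rewrite big_ord_recl coefMX eqxx scale0r add0r linear_sum.
by apply: eq_bigr => i _; rewrite coefMX /= linearZ.
Qed.

Lemma pactX x : pact 'X x = t x.
Proof. by rewrite -[X in pact X]mul1r pactMX pact1. Qed.

Lemma pactM p q x : pact (p * q) x = pact p (pact q x).
Proof.
elim/poly_ind: p => [|p c IHp]; first by rewrite mul0r !pact0.
rewrite mulrDl !pactD mulrAC !pactMX IHp pactC.
by rewrite mul_polyC pactZ.
Qed.

Lemma pactXsubC z x : pact ('X - z%:P) x = t x - z *: x.
Proof. by rewrite pactB pactX pactC. Qed.

Lemma pact_root_cons z s x :
  pact (root_prod (z :: s)) x = pact (root_prod s) (t x - z *: x).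
Proof. by rewrite /root_prod big_cons mulrC pactM pactXsubC. Qed.

Lemma pact_root_cons' z s x :
  pact (root_prod (z :: s)) x =
  t (pact (root_prod s) x) - z *: pact (root_prod s) x.
Proof. by rewrite /root_prod big_cons pactM pactXsubC. Qed.

Lemma pact_root_nil x : pact (root_prod [::]) x = x.
Proof. by rewrite /root_prod big_nil pact1. Qed.

Lemma pact_comm p x : pact p (t x) = t (pact p x).
Proof. by rewrite -!pactX -!pactM mulrC. Qed.

Lemma pact_commp p q x : pact p (pact q x) = pact q (pact p x).
Proof. by rewrite -!pactM mulrC. Qed.

Lemma pact_dvdp p q x : p %| q -> pact p x = 0 -> pact q x = 0.
Proof. by case/dvdpP=> r -> p0; rewrite pactM p0 linear0. Qed.

Lemma pact_eigen p z x : t x = z *: x -> pact p x = p.[z] *: x.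
Proof.
move=> tx; elim/poly_ind: p => [|p c IHp].
  by rewrite pact0 horner0 scale0r.
rewrite pactD pactMX IHp pactC linearZ /= tx hornerMXaddC scalerDl.
by rewrite scalerA.
Qed.

Lemma pact_root_eigen s z x :
  t x = z *: x -> x != 0 -> pact (root_prod s) x = 0 -> z \in s.
Proof.
move=> tx x0; rewrite (pact_eigen _ tx) => /eqP; rewrite scaler_eq0 (negPf x0).
by rewrite orbF /root_prod -[_ == 0]/(root _ z) root_prod_XsubC.
Qed.

(** Applying the factors one at a time, the last nonzero vector is an eigenvector. Its form
    [pact p x] keeps it in every [t]-stable subspace containing [x]. *)
Lemma pact_root_eigenvector s x : x != 0 -> pact (root_prod s) x = 0 ->
  exists z p, t (pact p x) = z *: pact p x /\ pact p x != 0.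
Proof.
elim: s => [|z s IHs] x0 sx; first by rewrite pact_root_nil in sx;
  rewrite sx eqxx in x0.
have [/eqP s0 | s0] := boolP (pact (root_prod s) x == 0); first exact: IHs.
exists z, (root_prod s); split=> //.
by move/eqP: sx; rewrite pact_root_cons' subr_eq0 => /eqP.
Qed.

(** When [z] fails [P], the operator [t - z] has no kernel in [W], so the factor ['X - z%:P] can be
    cancelled. *)
Lemma pact_root_filter (P : pred K) (W : V -> Prop) s :
    (forall z y, W y -> W (t y - z *: y)) ->
    (forall z y, W y -> ~~ P z -> t y = z *: y -> y = 0) ->
  forall x, W x -> pact (root_prod s) x = 0 ->
    pact (root_prod (filter P s)) x = 0.
Proof.
move=> Wt W0; have Ws r y : W y -> W (pact (root_prod r) y).
  elim: r y => [|z r IHr] y Wy; first by rewrite pact_root_nil.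
  by rewrite pact_root_cons; apply/IHr/Wt.
elim: s => [|z s IHs] x Wx //=.
case: ifPn => Pz; rewrite pact_root_cons => sx.
  by rewrite pact_root_cons; apply: IHs sx; exact: Wt.
apply: IHs => //; apply: (W0 z) => //; first exact: Ws.
by apply/eqP; rewrite -subr_eq0 -pact_root_cons' pact_root_cons sx.
Qed.

End PolyAct.

(** In dimension [n], the first [n + 1] iterates of [t] on a vector are dependent, which gives an
    annihilator of that vector. The product over a basis annihilates [V], and it splits. *)
Lemma pact_annihilator (K : closedFieldType) (V : vectType K)
    (t : {linear V -> V}) :
  exists s : seq K, forall x, pact t (root_prod s) x = 0.
Proof.
have ann1 x : exists p, p != 0 /\ pact t p x = 0.
  pose n := \dim {:V}.
  apply: contrapT => noP.
  have : free [seq iter i t x | i <- iota 0 n.+1].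
    pose X := [tuple iter i t x | i < n.+1].
    suff: free X.
      by rewrite -val_enum_ord -map_comp.
    apply/freeP => k k0 i; apply: contrapT => /eqP ki; apply: noP.
    exists (\poly_(j < n.+1) k (inord j)); split.
      apply/eqP => /polyP/(_ i); rewrite coef_poly ltn_ord inord_val coef0.
      exact/eqP.
    rewrite (@pact_widen _ _ _ n.+1) ?size_poly // -[RHS]k0.
    apply: eq_bigr => j _; rewrite coef_poly ltn_ord inord_val.
    by rewrite (nth_map j) ?size_enum_ord // nth_ord_enum.
  rewrite /free size_map size_iota => /eqP dimX.
  by have := dimvS (subvf <<[seq iter i t x | i <- iota 0 n.+1]>>);
    rewrite dimX ltnn.
have [p [p0 pV]] : exists p, p != 0 /\ forall x, pact t p x = 0.
  suff [p [p0 pX]]: exists p, p != 0 /\ {in tval (vbasis {:V}), forall x, pact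
    t p x = 0}.
    exists p; split=> // x; rewrite (coord_vbasis (memvf x)) linear_sum big1 //
      => i _.
    by rewrite linearZ /= pX ?scaler0 // mem_nth ?size_tuple.
  elim: (tval (vbasis {:V})) => [|x X [p [p0 pX]]].
    by exists 1; rewrite oner_eq0; split.
  have [q [q0 qx]] := ann1 x.
  exists (p * q); rewrite mulf_neq0 //; split=> // y.
  rewrite inE => /predU1P[-> | Xy]; first by rewrite pactM qx linear0.
  by rewrite mulrC pactM pX ?linear0.
have [s ps] := closed_field_poly_normal p.
exists s => x; move: (pV x); rewrite ps pactZ => /eqP.
by rewrite scaler_eq0 lead_coef_eq0 (negPf p0) => /eqP.
Qed.

(* [A - a], [B - b] being injective away from their eigenvalues, [beta x y] is
   driven to an eigenvector of [C] with eigenvalue [a * b]. *)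
Lemma bilinear_spectrum (K : fieldType) (U V W : lmodType K) (beta : U -> V ->
  W)
    (A : {linear U -> U}) (B : {linear V -> V}) (C : {linear W -> W})
    (s1 s2 s3 : seq K) :
    (forall y, linear (beta^~ y)) -> (forall x, linear (beta x)) ->
    {in s1 & s2, forall a b, a * b \notin s3} ->
  forall (U' : U -> Prop) (V' : V -> Prop),
    (forall a x, U' x -> U' (A x - a *: x)) ->
    (forall b y, V' y -> V' (B y - b *: y)) ->
    (forall x y, U' x -> V' y -> beta (A x) (B y) = C (beta x y)) ->
    (forall x y, U' x -> V' y -> pact C (root_prod s3) (beta x y) = 0) ->
  forall x y, U' x -> V' y ->
    pact A (root_prod s1) x = 0 -> pact B (root_prod s2) y = 0 -> beta x y = 0.
Proof.
move=> bl br s123 U' V' AU BV bC C0 x y U'x V'y.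
have b0l v : beta 0 v = 0 by have := bl v (-1) x x; rewrite !scaleN1r !addNr.
have b0r u : beta u 0 = 0 by have := br u (-1) y y; rewrite !scaleN1r !addNr.
elim: s1 s123 x U'x y V'y => [|a s1 IH1] s123 x U'x y V'y.
  by rewrite pact_root_nil => ->.
have {}IH1 : forall x' y', U' x' -> V' y' -> pact A (root_prod s1) x' = 0 ->
    pact B (root_prod s2) y' = 0 -> beta x' y' = 0.
  move=> x' y' U'x' V'y'; apply: IH1 => // a' b' a's1; apply: s123.
  by rewrite inE a's1 orbT.
elim: s2 s123 IH1 y V'y => [|b s2 IH2] s123 IH1 y V'y.
  by rewrite pact_root_nil => _ ->.
move=> sx sy; move: (sx) (sy); rewrite !pact_root_cons => sx' sy'.
(* [A x - a *: x] needs one root fewer than [x], and [B y] is annihilated together with [y]. *)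
have x'0 : beta (A x - a *: x) (B y) = 0.
  apply: IH1 => //; first exact: AU.
    by have := BV 0 _ V'y; rewrite scale0r subr0.
  by rewrite pact_comm sy linear0.
have y'0 : beta x (B y - b *: y) = 0.
  apply: IH2 => //; last exact: BV.
    by move=> a' b' a'1 b's2; apply: s123 => //; rewrite inE b's2 orbT.
  by move=> x' U'x' y1 V'y1 sx1 sy1; apply: IH1;
    rewrite // pact_root_cons' sy1 linear0 scaler0 subr0.
have Cb : C (beta x y) = (a * b) *: beta x y.
  rewrite -bC //; move: x'0; rewrite addrC -scaleNr bl scaleNr addrC => /eqP.
  rewrite subr_eq0 => /eqP ->; move: y'0;
    rewrite addrC -scaleNr br scaleNr addrC.
  by move=> /eqP; rewrite subr_eq0 => /eqP ->; rewrite scalerA.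
apply/eqP; apply: contraT => bn0.
have ab: a \in a :: s1 by rewrite mem_head.
have bb: b \in b :: s2 by rewrite mem_head.
by have := s123 a b ab bb; rewrite (pact_root_eigen Cb bn0 (C0 _ _ U'x V'y)).
Qed.

(** * The square root polynomial *)

Section Hensel.
Variable R : rcfType.
Local Notation C := R[i].
Implicit Types (l z : C) (s : seq C) (f : {poly C}).

(** The order on [C] is partial: [0 < l] says that [l] is real and positive, so nonreal eigenvalues
    get the sign [-1] like the negative ones. *)
Definition pos_sign l : C := if 0 < l then 1 else -1.

(** For [l != 0], this is the square root of [pos_sign l / l] in the open right half-plane. *)
Definition principal_root l z := 0 < complex.Re z /\ z ^+ 2 * l = pos_sign l.

Lemma pos_sign_sqr l : pos_sign l ^+ 2 = 1.
Proof. by rewrite /pos_sign; case: ifP; rewrite ?expr1n // sqrrN expr1n. Qed.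

Lemma principal_root_neq0 l z : principal_root l z -> z != 0.
Proof. by case=> z0 _; apply: contraTneq z0 => ->; rewrite ltxx. Qed.

Lemma sqr_Re0 z : complex.Re z = 0 -> z ^+ 2 <= 0.
Proof.
case: z => a b /= ->; rewrite expr2 lecE /= !mul0r mulr0 addr0 sub0r eqxx.
by rewrite oppr_le0 -expr2 sqr_ge0.
Qed.

(** The sign is chosen so that [pos_sign l / l] is never real and nonpositive. Its square roots are
    thus not purely imaginary, and one of the two opposite roots has positive real part. *)
Lemma principal_root_exists l : l != 0 -> exists z, principal_root l z.
Proof.
move=> l0; pose u := pos_sign l / l.
have u0 : ~~ (u <= 0).
  apply/negP; rewrite /u /pos_sign; case: ifPn => [lp|].
    by rewrite mul1r le_eqVlt invr_eq0 (negPf l0) invr_lt0 /= =>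
      /(lt_trans lp); rewrite ltxx.
  by rewrite mulN1r oppr_le0 invr_ge0 le_eqVlt eq_sym (negPf l0) /= => /negP.
have ul : u * l = pos_sign l by rewrite /u mulfVK.
have zu := sqr_sqrtc u; set z := sqrtc u in zu.
case: (ltgtP (complex.Re z) 0) => z0.
- exists (- z); split; last by rewrite sqrrN zu.
  by case: (z) z0 => a b /=; rewrite oppr_gt0.
- by exists z; split; rewrite ?zu.
- by rewrite -zu sqr_Re0 in u0.
Qed.

Lemma principal_root_uniq l z z' : l != 0 -> principal_root l z ->
  principal_root l z' -> z = z'.
Proof.
move=> l0 [z0 zl] [z'0]; rewrite -zl => /(mulIf l0)/eqP; rewrite eqf_sqr.
case/orP=> /eqP // zz'; case: z z' z0 z'0 zz' {zl} => a b [c d] /= a0 c0 [ca _].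
by move: c0; rewrite ca oppr_gt0 => /(lt_trans a0); rewrite ltxx.
Qed.

Lemma conjc_gt0 l : (0 < l^*%C) = (0 < l).
Proof. by case: l => a b; rewrite !ltcE /= oppr_eq0. Qed.

Lemma pos_sign_conj l : pos_sign l^*%C = pos_sign l.
Proof. by rewrite /pos_sign conjc_gt0. Qed.

Lemma principal_root_conj l z : principal_root l z -> principal_root l^*%C
  z^*%C.
Proof.
case=> z0 zl; split; first by case: z z0 {zl}.
rewrite pos_sign_conj -rmorphXn -rmorphM zl /= /pos_sign.
by case: ifP; rewrite ?rmorphN rmorph1.
Qed.

Lemma root_prod_root s l : root (root_prod s) l = (l \in s).
Proof. exact: root_prod_XsubC. Qed.

(* Newton iteration: the roots [principal_root l] of [z^4 l^2 = 1] are simple. *)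
Lemma hensel_root s : {in s, forall l, l != 0} -> exists f,
  root_prod s %| f ^+ 4 * 'X ^+ 2 - 1 /\ {in s, forall l, principal_root l
    f.[l]}.
Proof.
elim: s => [|l s IHs] s0.
  by exists 0; rewrite /root_prod big_nil dvd1p.
have l0 : l != 0 by apply: s0; rewrite mem_head.
case: IHs => [l' l's | f [sf froot]]; first by rewrite s0 // inE l's orbT.
pose m := root_prod s; have ml : root_prod (l :: s) = ('X - l%:P) * m.
  by rewrite /root_prod big_cons.
(* Expansion of the fourth power in [c *: m]: the linear term is explicit, and [m ^+ 2 * k] collects
   the higher ones. *)
have newton c : exists k, (f + c *: m) ^+ 4 * 'X ^+ 2 - 1 =
    (f ^+ 4 * 'X ^+ 2 - 1) + m * ((c *+ 4)%:P * (f ^+ 3 * 'X ^+ 2) + m * k).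
  exists (c%:P ^+ 2 * (6%:R * f ^+ 2 + 4%:R * c%:P * f * m + c%:P ^+ 2 * m ^+ 2)
    * 'X ^+ 2).
  by rewrite -mul_polyC polyCMn -[c%:P *+ 4]mulr_natl; ring.
have fm c l' : l' \in s -> (f + c *: m).[l'] = f.[l'].
  move=> l's; rewrite hornerD hornerZ;
    suff /rootP ->: root m l' by rewrite mulr0 addr0.
  by rewrite root_prod_root.
have [ls | nls] := boolP (l \in s).
  have [h fh] := dvdpP _ _ sf.
  have fl0 : f.[l] != 0 by apply: principal_root_neq0 (froot l ls).
  (* At a repeated root the values of [f] stay, and [c] solves the linearized equation, whose
     coefficient [4 f(l)^3 l^2] is nonzero. *)
  have [c hc] : exists c, h.[l] + c *+ 4 * (f.[l] ^+ 3 * l ^+ 2) = 0.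
    exists (- h.[l] / (4%:R * (f.[l] ^+ 3 * l ^+ 2))).
    by rewrite -[_ *+ 4]mulr_natl; field; rewrite fl0 l0.
  exists (f + c *: m); split; last first.
    move=> l'; rewrite inE => /predU1P[-> | l's]; rewrite fm //; exact: froot.
  have [k ->] := newton c.
  rewrite ml fh [h * _]mulrC -mulrDr mulrC dvdp_mul2l; last first.
    by rewrite monic_neq0 // monic_prod_XsubC.
  rewrite dvdp_XsubCl; apply/rootP; rewrite addrA hornerD [(m * k).[l]]hornerM.
  have /rootP ->: root m l by rewrite root_prod_root.
  by rewrite mul0r addr0 hornerD hornerM hornerC hornerM !horner_exp hornerX.
have [z zl] := principal_root_exists l0.
have mn0 : m.[l] != 0 by rewrite -[_ == 0]/(root m l) root_prod_root.
(* At a new root, [c] interpolates the value [z]; the values at the earlier roots do not move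
   because [m] vanishes there. *)
pose c := (z - f.[l]) / m.[l].
have fl : (f + c *: m).[l] = z by rewrite hornerD hornerZ divfK // addrC subrK.
exists (f + c *: m); split; last first.
  move=> l'; rewrite inE => /predU1P[-> | l's]; first by rewrite fl.
  by rewrite fm //; exact: froot.
rewrite ml Gauss_dvdp; last by rewrite coprimep_sym coprimep_XsubC
  root_prod_root.
have [k newt] := newton c; apply/andP; split;
  last by rewrite newt dvdp_add ?dvdp_mulr.
rewrite dvdp_XsubCl; apply/rootP;
  rewrite hornerD hornerM !horner_exp hornerX fl.
rewrite hornerN hornerC; case: zl => _ zl.
have -> : z ^+ 4 * l ^+ 2 = (z ^+ 2 * l) ^+ 2 by ring.
by rewrite zl pos_sign_sqr subrr.
Qed.

Lemma root_prod_conj s :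
  map_poly conjc (root_prod s) = root_prod [seq l^*%C | l <- s].
Proof.
rewrite /root_prod rmorph_prod big_map; apply: eq_bigr => l _ /=.
by rewrite rmorphB /= map_polyX map_polyC.
Qed.

(** The conjugate [g] of [f] solves the same problem, and takes the same values on [s] by uniqueness
    of principal roots. The difference of the two equations is [g - f] times a cofactor [k] equal to
    [4 f(l)^3 l^2] at each root [l], hence prime to [root_prod s]. *)
Lemma hensel_real_root s : {in s, forall l, l != 0} ->
    perm_eq [seq l^*%C | l <- s] s -> exists f,
  [/\ root_prod s %| f ^+ 4 * 'X ^+ 2 - 1, {in s, forall l, principal_root l
    f.[l]}
    & root_prod s %| map_poly conjc f - f].
Proof.
move=> s0 sJ; have [f [sf froot]] := hensel_root s0; exists f; split=> //.
pose g := map_poly conjc f.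
have sg : root_prod s %| g ^+ 4 * 'X ^+ 2 - 1.
  have <- : map_poly conjc (root_prod s) = root_prod s.
    by rewrite root_prod_conj; exact: perm_big.
  have -> : g ^+ 4 * 'X ^+ 2 - 1 = map_poly conjc (f ^+ 4 * 'X ^+ 2 - 1).
    by rewrite rmorphB rmorphM !rmorphXn /= map_polyX rmorph1.
  by rewrite dvdp_map.
have gf : {in s, forall l, g.[l] = f.[l]}.
  move=> l ls; apply: (principal_root_uniq (s0 l ls)); last exact: froot.
  have lJs : l^*%C \in s by rewrite -(perm_mem sJ); apply: map_f.
  have := principal_root_conj (froot _ lJs); rewrite conjcK.
  by rewrite /g -[in g.[l]](conjcK l) -horner_map.
pose k := (g + f) * (g ^+ 2 + f ^+ 2) * 'X ^+ 2.
have : root_prod s %| (g - f) * k.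
  have -> : (g - f) * k = (g ^+ 4 * 'X ^+ 2 - 1) - (f ^+ 4 * 'X ^+ 2 - 1).
    by rewrite /k; ring.
  by rewrite dvdp_sub.
rewrite Gauss_dvdpl //; rewrite /root_prod big_seq coprimep_sym.
apply: (big_ind (coprimep k)) => [|p q|l ls]; rewrite ?coprimep1 //.
  by rewrite coprimepMr => -> ->.
rewrite coprimep_XsubC /root !(hornerE, horner_exp) gf //.
have /principal_root_neq0 fl0 := froot l ls.
by rewrite -!mulr2n !mulf_neq0 ?mulrn_eq0 ?expf_neq0 // s0.
Qed.

End Hensel.

(** * Coordinates of vectors and complex scalars *)

Section VectorCoordinate.
Variables (K : fieldType) (V : vectType K).
Implicit Types (x y : V).

Definition vcoord x i := coord (vbasis {:V}) i x.

Lemma vcoordP x y : vcoord x =1 vcoord y -> x = y.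
Proof.
move=> xy; rewrite (coord_vbasis (memvf x)) (coord_vbasis (memvf y)).
by apply: eq_bigr => i _; congr (_ *: _); exact: xy.
Qed.

Lemma vcoordD x y i : vcoord (x + y) i = vcoord x i + vcoord y i.
Proof. exact: linearD. Qed.

Lemma vcoordN x i : vcoord (- x) i = - vcoord x i.
Proof. exact: linearN. Qed.

Lemma vcoordZ a x i : vcoord (a *: x) i = a * vcoord x i.
Proof. exact: linearZ. Qed.

Lemma vcoord0 i : vcoord 0 i = 0.
Proof. exact: linear0. Qed.

Definition vcoordE := (vcoordD, vcoordN, vcoordZ, vcoord0).

End VectorCoordinate.

(* Linear identities between vectors are ring identities between coordinates. *)
Ltac vring := let i := fresh in apply: vcoordP => i; rewrite ?vcoordE; ring.

HB.instance Definition _ (K : fieldType) (V : lieAlgType K) (x : V) :=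
  GRing.isLinear.Build K V V _ (lie x) (lie_linearr x).

Section ComplexScalars.
Variable R : rcfType.
Local Notation C := R[i].

Lemma conj_imag : ('i%C : C)^*%C = - 'i%C.
Proof. by simpc. Qed.

Lemma imag_sqr : 'i%C * 'i%C = -1 :> C.
Proof. by rewrite -expr2 sqr_i. Qed.

Lemma complex_parts (z : C) : z = (complex.Re z)%:C%C + (complex.Im z)%:C%C *
  'i%C.
Proof. by rewrite mulrC -complexE. Qed.

Lemma complex_conj_parts (z : C) :
  z^*%C = (complex.Re z)%:C%C - (complex.Im z)%:C%C * 'i%C.
Proof. by case: z => a b; simpc. Qed.

Variable V : vectType C.

Lemma half_double (x : V) : 2%:R^-1 *: (x + x) = x.
Proof. by apply: vcoordP => i; rewrite ?vcoordE; field. Qed.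

Lemma half_sum_diff (x y : V) : x = 2%:R^-1 *: (x + y) + 2%:R^-1 *: (x - y).
Proof. by apply: vcoordP => i; rewrite ?vcoordE; field. Qed.

End ComplexScalars.

(** * Normalization of an antilinear automorphism *)

Definition antilinear (R : rcfType) (V W : lmodType R[i]) (s : V -> W) :=
  forall a x y, s (a *: x + y) = a^*%C *: s x + s y.

Definition lie_morph (K : fieldType) (V W : lieAlgType K) (s : V -> W) :=
  forall x y, s (lie x y) = lie (s x) (s y).

Section Antilinear.
Variables (R : rcfType) (V W : lmodType R[i]) (s : V -> W).
Hypothesis sL : antilinear s.

Lemma antilinearD x y : s (x + y) = s x + s y.
Proof. by have := sL 1 x y; rewrite conjc1 !scale1r. Qed.

Lemma antilinear0 : s 0 = 0.
Proof. by apply: (addrI (s 0)); rewrite -antilinearD !addr0. Qed.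

Lemma antilinearZ a x : s (a *: x) = a^*%C *: s x.
Proof. by have := sL a x 0; rewrite antilinear0 !addr0. Qed.

Lemma antilinearN x : s (- x) = - s x.
Proof. by rewrite -scaleN1r antilinearZ rmorphN rmorph1 scaleN1r. Qed.

Lemma antilinearB x y : s (x - y) = s x - s y.
Proof. by rewrite antilinearD antilinearN. Qed.

Lemma antilinear_sum I (r : seq I) (P : pred I) (F : I -> V) :
  s (\sum_(i <- r | P i) F i) = \sum_(i <- r | P i) s (F i).
Proof. exact: (big_morph s antilinearD antilinear0). Qed.

End Antilinear.

Section Normalize.
Variables (R : rcfType) (V : vectLieAlgType R[i]) (sigma : V -> V).
Hypotheses (sigmaL : antilinear sigma) (sigma_lie : lie_morph sigma)
  (sigma_inj : injective sigma).
Local Notation C := R[i].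

Definition sigma_sqr x := sigma (sigma x).

Lemma sigma_sqr_linear : linear sigma_sqr.
Proof. by move=> a x y; rewrite /sigma_sqr !sigmaL conjcK. Qed.

HB.instance Definition _ :=
  GRing.isLinear.Build C V V _ sigma_sqr sigma_sqr_linear.

Local Notation tau := (sigma_sqr : {linear V -> V}).

Lemma sigma_sqr_lie : lie_morph tau.
Proof. by move=> x y /=; rewrite /sigma_sqr !sigma_lie. Qed.

Lemma sigma_pact p x : sigma (pact tau p x) = pact tau (map_poly conjc p)
  (sigma x).
Proof.
elim/poly_ind: p => [|p c IHp]; first by rewrite map_poly0 !pact0 antilinear0.
rewrite rmorphD rmorphM /= map_polyX map_polyC !pactD !pactMX !pactC.
by rewrite antilinearD // antilinearZ // -IHp.
Qed.

Lemma pact_stable (U : {vspace V}) p x :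
  (forall y, y \in U -> sigma y \in U) -> x \in U -> pact tau p x \in U.
Proof.
move=> Us Ux; elim/poly_ind: p => [|p c IHp]; first by rewrite pact0 mem0v.
by rewrite pactD pactMX pactC memvD ?memvZ //; apply/Us/Us.
Qed.

(** The arguments of [z] and [z'] lie strictly between [-pi/2] and [pi/2], so their sum cannot reach
    [pi] or [-pi]. *)
Lemma Re_pos_mul (z z' p : C) :
  0 < complex.Re z -> 0 < complex.Re z' -> 0 < p -> z * z' != - p.
Proof.
case: z z' p => [a b] [c d] [p p'] /= a0 c0;
  rewrite ltcE /= => /andP[/eqP -> p0].
apply/eqP => -[/eqP]; rewrite oppr0 => re /eqP; rewrite addr_eq0 => /eqP im.
have : a * (a * c - b * d) = c * (a ^+ 2 + b ^+ 2).
  have -> : a * (a * c - b * d) = a ^+ 2 * c - b * (a * d) by ring.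
  by rewrite im; ring.
rewrite (eqP re) mulrN => /eqP; rewrite lt_eqF //.
apply: (@lt_trans _ _ 0); first by rewrite oppr_lt0 mulr_gt0.
by rewrite mulr_gt0 // ltr_pwDl ?sqr_ge0 // exprn_gt0.
Qed.

Lemma Re_pos_scale (z z' p : C) :
  0 < complex.Re z -> 0 < complex.Re z' -> 0 < p -> p * z != - z'.
Proof.
case: z z' p => [a b] [c d] [p p'] /= a0 c0;
  rewrite ltcE /= => /andP[/eqP -> p0].
apply/eqP => -[/eqP]; rewrite mul0r subr0 => /eqP pa.
by move: (mulr_gt0 p0 a0); rewrite pa oppr_gt0 => /(lt_trans c0); rewrite ltxx.
Qed.

Lemma principal_root_gt0 (l z : C) : 0 < l -> principal_root l z -> 0 < z.
Proof.
move=> l0 [z0]; rewrite /pos_sign l0 expr2.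
case: z l z0 l0 => [a b] [l l'] /= a0; rewrite ltcE /= => /andP[/eqP -> l0].
case=> _; rewrite mulr0 add0r => /eqP; rewrite mulf_eq0 (gt_eqF l0) orbF.
rewrite [b * a]mulrC -mulr2n mulrn_eq0 /= mulf_eq0 (gt_eqF a0) /= => /eqP ->.
by rewrite ltcE /= eqxx.
Qed.

(** Spectral mapping: ['X - l%:P] divides [p - p.[l]%:P], so each factor for [p(tau)] absorbs one
    for [tau]. *)
Lemma pact_eval_root p s (x : V) : pact tau (root_prod s) x = 0 ->
  pact (pact tau p : {linear V -> V}) (root_prod [seq p.[l] | l <- s]) x = 0.
Proof.
elim: s x => [|l s IHs] x; rewrite ?pact_root_nil //= !pact_root_cons => sx.
apply: IHs; have /factor_theorem[h hE] : root (p - p.[l]%:P) l.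
  by rewrite /root hornerD hornerN hornerC subrr.
have -> : pact tau p x - p.[l] *: x = pact tau h (tau x - l *: x).
  by rewrite -(pactC tau) -pactB hE pactM pactXsubC.
by rewrite pact_commp sx linear0.
Qed.

(** Positive times positive is positive, and positive times nonpositive is not positive, which gives
    two grading rules for [eps]. A product of two eigenvalues that are not positive is
    unconstrained, so the third rule remains a hypothesis of the last clause. *)
Lemma normalize : exists sigma0 : V -> V,
  [/\ antilinear sigma0,
      forall x, sigma0 (sigma0 (sigma0 (sigma0 x))) = x,
      forall U : {vspace V}, (forall x, x \in U -> sigma x \in U) ->
        forall x, x \in U -> sigma0 x \in U,
      forall x, sigma (sigma0 (sigma0 x)) = sigma0 (sigma0 (sigma x)) &
    let eps x := sigma0 (sigma0 x) in
    [/\ forall x y, eps x = x -> eps y = y -> eps (lie x y) = lie x y,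
        forall x y, eps x = x -> eps y = - y -> eps (lie x y) = - lie x y &
        (forall x y, eps x = - x -> eps y = - y -> eps (lie x y) = lie x y) ->
        lie_morph sigma0]].
Proof.
have [s0 s0V] := pact_annihilator tau.
pose s1 := filter (fun l => l != 0) s0.
have s1V x : pact tau (root_prod s1) x = 0.
  apply: (@pact_root_filter _ _ _ _ (fun _ => True)) => // z y _ /negPn/eqP ->.
  rewrite scale0r => ty0; apply/sigma_inj/sigma_inj.
  by rewrite !(antilinear0 sigmaL).
(* Closing the list under conjugation allows [f] to be real modulo [root_prod s], so that [q]
   commutes with [sigma]. *)
pose s := s1 ++ [seq l^*%C | l <- s1].
have sV x : pact tau (root_prod s) x = 0.
  by rewrite /root_prod big_cat /= mulrC -/(root_prod s1) pactM s1V linear0.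
have sn0 : {in s, forall l, l != 0}.
  move=> l; rewrite mem_cat mem_filter => /orP[/andP[] // | /mapP[l' l's ->]].
  by rewrite conjc_eq0; move: l's; rewrite mem_filter => /andP[].
have sJ : perm_eq [seq l^*%C | l <- s] s.
  by rewrite map_cat (mapK (@conjcK R)) perm_catC.
have [f [sf froot fJ]] := hensel_real_root sn0 sJ.
have dvd0 p : root_prod s %| p -> forall x, pact tau p x = 0.
  by move=> sp x; apply: pact_dvdp sp (sV x).
pose q := pact tau f.
have qs x : sigma (q x) = q (sigma x).
  by apply/eqP; rewrite sigma_pact -subr_eq0 -pactB dvd0.
pose eps := pact tau (f ^+ 2 * 'X).
have epsE x : sigma (q (sigma (q x))) = eps x.
  rewrite -qs /eps /q pactM [in RHS]pact_commp pactX exprS expr1 pactM.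
  by rewrite /= /sigma_sqr -/q !qs.
have epsK x : eps (eps x) = x.
  apply/eqP; rewrite /eps -pactM -subr_eq0 -[X in _ - X](pact1 tau) -pactB.
  by rewrite dvd0 // (_ : _ - 1 = f ^+ 4 * 'X ^+ 2 - 1) //; ring.
have eps_sigma x : sigma (eps x) = eps (sigma x) by rewrite -!epsE !qs.
have tau_eps x : eps (tau x) = tau (eps x) by rewrite /eps pact_comm.
have tau_q x : q (tau x) = tau (q x) by rewrite /q pact_comm.
have eps_q x : eps (q x) = q (eps x) by rewrite /eps /q pact_commp.
have epsZ a x y : eps (a *: x + y) = a *: eps x + eps y by rewrite /eps linearP.
have epsB x y : eps (x - y) = eps x - eps y by rewrite /eps linearB.
have eps_eigen l x : tau x = l *: x -> eps x = pos_sign l *: x.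
  have [-> _ | x0 tx] := eqVneq x 0; first by rewrite /eps linear0 scaler0.
  have ls : l \in s by apply: pact_root_eigen tx x0 (sV x).
  rewrite /eps (pact_eigen _ tx) hornerM hornerX horner_exp.
  by have [_ ->] := froot l ls.
pose sp := [seq l <- s | 0 < l]; pose sm := [seq l <- s | ~~ (0 < l)].
have two0 (x : V) : x = - x -> x = 0.
  by move/eqP; rewrite -addr_eq0 -mulr2n -scaler_nat scaler_eq0 pnatr_eq0 =>
    /eqP.
have spV x : eps x = x -> pact tau (root_prod sp) x = 0.
  move=> ex; apply: (@pact_root_filter _ _ _ _ (fun y => eps y = y)) (sV x) =>
    //.
    by move=> z y ey; rewrite addrC -scaleNr epsZ ey tau_eps ey.
  move=> z y ey /negPf zn /eps_eigen; rewrite ey /pos_sign zn scaleN1r.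
  exact: two0.
have smV x : eps x = - x -> pact tau (root_prod sm) x = 0.
  move=> ex; apply: (@pact_root_filter _ _ _ _ (fun y =>
    eps y = - y)) (sV x) => //.
    move=> z y ey; rewrite addrC -scaleNr epsZ ey tau_eps ey opprD scalerN.
    by rewrite linearN.
  move=> z y ey /negPn zn /eps_eigen; rewrite ey /pos_sign zn scale1r.
  by move/esym; exact: two0.
have [mulpp mulpm] : {in sp & sp, forall a b, a * b \notin sm} /\
    {in sp & sm, forall a b, a * b \notin sp}.
  split=> a b; rewrite !mem_filter => /andP[a0 _] /andP[b0 _].
    by rewrite mulr_gt0.
  by rewrite pmulr_rgt0 // (negPf b0).
(* For [c = -1] and [c = 1] this is twice the odd and twice the even component of the bracket;
   [bilinear_spectrum] will show that the component of the wrong parity vanishes. *)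
have lieBl c (y : V) : linear (fun x => lie x y + c *: eps (lie x y)).
  move=> a x x'; rewrite lieDl lieZl epsZ !scalerDr !scalerA [c * a]mulrC.
  by rewrite addrACA.
have lieBr c (y : V) : linear (fun x => lie y x + c *: eps (lie y x)).
  move=> a x x'; rewrite lieDr lieZr epsZ !scalerDr !scalerA [c * a]mulrC.
  by rewrite addrACA.
have Wt1 : forall a x, eps x = x -> eps (tau x - a *: x) = tau x - a *: x.
  by move=> a x ex; rewrite addrC -scaleNr epsZ ex tau_eps ex.
have Wt2 : forall a x, eps x = - x -> eps (tau x - a *: x) = - (tau x - a *: x).
  move=> a x ex; rewrite addrC -scaleNr epsZ ex tau_eps ex opprD scalerN.
  by rewrite linearN.
have tauZ a x y : tau (x + a *: y) = tau x + a *: tau y.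
  by rewrite addrC linearP addrC.
have gpp x y : eps x = x -> eps y = y -> eps (lie x y) = lie x y.
  move=> ex ey; apply/esym/eqP; rewrite -subr_eq0 -scaleN1r; apply/eqP.
  move: x y ex ey (spV x ex) (spV y ey) => x y ex ey;
    apply: (@bilinear_spectrum _ _ _ _ (fun x y =>
      lie x y + (-1) *: eps (lie x y))
    tau tau tau _ _ _ (lieBl _) (lieBr _) mulpp _ _ Wt1 Wt1) => //.
    by move=> u v _ _; rewrite tauZ -tau_eps !sigma_sqr_lie.
  by move=> u v eu ev; apply: smV;
    rewrite addrC epsZ epsK !scaleN1r opprD opprK addrC.
have gpm x y : eps x = x -> eps y = - y -> eps (lie x y) = - lie x y.
  move=> ex ey; apply/eqP; rewrite -addr_eq0 addrC -[eps _]scale1r; apply/eqP.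
  move: x y ex ey (spV x ex) (smV y ey) => x y ex ey;
    apply: (@bilinear_spectrum _ _ _ _ (fun x y => lie x y + 1 *: eps (lie x y))
    tau tau tau _ _ _ (lieBl _) (lieBr _) mulpm _ _ Wt1 Wt2) => //.
    by move=> u v _ _; rewrite tauZ -tau_eps !sigma_sqr_lie.
  by move=> u v eu ev; apply: spV; rewrite addrC epsZ epsK !scale1r addrC.
exists (fun x => sigma (q x)); split=> //.
- by move=> a x y; rewrite /q linearP sigmaL.
- by move=> x; rewrite !epsE epsK.
- by move=> U Us x Ux; apply: (Us); exact: (pact_stable f Us Ux).
- by move=> x; rewrite /= !epsE eps_sigma.
have epsE' : (fun x => sigma (q (sigma (q x)))) = eps by apply/funext.
rewrite epsE' /=; split=> // gmm.
suff q_lie : lie_morph q by move=> x y; rewrite q_lie sigma_lie.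
have dec x : exists u v, [/\ x = u + v, eps u = u & eps v = - v].
  exists (2%:R^-1 *: (x + eps x)), (2%:R^-1 *: (x - eps x)); split.
  - by rewrite -scalerDr addrACA subrr addr0 half_double.
  - by rewrite /eps linearZ linearD /= -/eps epsK addrC.
  - by rewrite /eps linearZ linearB /= -/eps epsK -scalerN opprB.
have gmp x y : eps x = - x -> eps y = y -> eps (lie x y) = - lie x y.
  by move=> ex ey; rewrite lieC /eps linearN /= -/eps gpm.
have eps_lie : lie_morph eps.
  move=> x y; have [u [u' [-> eu eu']]] := dec x.
  have [v [v' [-> ev ev']]] := dec y.
  have epsD a b : eps (a + b) = eps a + eps b by rewrite /eps linearD.
  rewrite !(lieDl, lieDr) !epsD eu eu' ev ev' !(lieDl, lieDr).
  rewrite (gpp u v) // (gpm u v') // (gmp u' v) // (gmm u' v') //.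
  by rewrite !(lieNl, lieNr) opprK.
(* [q^2] is the quotient of the automorphisms [eps] and [tau]. *)
have q2_lie x y : q (q (lie x y)) = lie (q (q x)) (q (q y)).
  have q2tau z : q (q (tau z)) = eps z.
    by rewrite /eps pactM pactX expr2 pactM.
  have tau_surj z : exists z', z = tau z'.
    by exists (q (q (eps z))); rewrite -!tau_q q2tau epsK.
  have [x' ->] := tau_surj x; have [y' ->] := tau_surj y.
  by rewrite -sigma_sqr_lie !q2tau eps_lie.
(* The defect of [q]. Since [q^2] respects brackets, [D (q u) (q v) = - q (D u v)], so [D] can be
   nonzero only where [f(a) f(b) = - f(c)] for eigenvalues [a], [b], [c] of matching parities. *)
pose D x y := lie (q x) (q y) - q (lie x y).
suff D0 x y : D x y = 0 by move=> x y; apply/esym/eqP;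
  rewrite -subr_eq0 -/(D x y) D0.
have qL a u v : q (a *: u + v) = a *: q u + q v by rewrite /q linearP.
have Dl z : linear (D^~ z).
  move=> a u v; rewrite /D qL !(lieDl, lieZl) qL scalerBr opprD addrACA.
  by [].
have Dr z : linear (D z).
  move=> a u v; rewrite /D qL !(lieDr, lieZr) qL scalerBr opprD addrACA.
  by [].
have Dq u v : D (q u) (q v) = pact tau (- f) (D u v).
  by rewrite /D -q2_lie pactN /= -/q /q linearB opprB.
have qN u : q (- u) = - q u by rewrite /q linearN.
have qt1 a u : eps u = u -> eps (q u - a *: u) = q u - a *: u.
  by move=> eu; rewrite addrC -scaleNr epsZ eps_q eu.
have qt2 a u : eps u = - u -> eps (q u - a *: u) = - (q u - a *: u).
  move=> eu; rewrite addrC -scaleNr epsZ eps_q eu opprD scalerN.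
  by rewrite /q linearN.
have Dspec (U' V' : V -> Prop) (s1' s2' s3' : seq C) :
    (forall a b c, a \in s1' -> b \in s2' -> c \in s3' ->
      f.[a] * f.[b] != - f.[c]) ->
    (forall a u, U' u -> U' (q u - a *: u)) ->
    (forall a u, V' u -> V' (q u - a *: u)) ->
    (forall u v, U' u -> V' v -> pact tau (root_prod s3') (D u v) = 0) ->
    (forall u, U' u -> pact tau (root_prod s1') u = 0) ->
    (forall v, V' v -> pact tau (root_prod s2') v = 0) ->
    forall u v, U' u -> V' v -> D u v = 0.
  move=> ss Uq Vq D3 U1 V2 x' y' Ux Vy.
  apply: (@bilinear_spectrum _ _ _ _ D (pact tau f) (pact tau f) (pact tau (-
    f))
    [seq f.[l] | l <- s1'] [seq f.[l] | l <- s2'] [seq (- f).[l] | l <- s3']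
    Dl Dr _ U' V' Uq Vq) => //; last 2 first.
  - by apply: pact_eval_root; exact: U1.
  - by apply: pact_eval_root; exact: V2.
  - move=> _ _ /mapP[a a1 ->] /mapP[b b2 ->]; apply/negP => /mapP[c c3].
    by rewrite hornerN; apply/eqP; exact: ss.
  - by move=> u v Uu Vv; apply: pact_eval_root; exact: D3.
have Re_f l : l \in s -> 0 < complex.Re f.[l] by case/froot.
have fp l : l \in s -> 0 < l -> 0 < f.[l].
  by move=> ls l0; exact: principal_root_gt0 l0 (froot l ls).
have inp l : l \in sp -> l \in s /\ 0 < l.
  by rewrite mem_filter => /andP[].
have inm l : l \in sm -> l \in s by rewrite mem_filter => /andP[].
(* [f] is positive on [sp] and has positive real part on [s]. The equation [f(a) f(b) = - f(c)] is
   thus excluded whenever [c] or [a] lies in [sp], which covers all parities. *)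
have Dpp u v : eps u = u -> eps v = v -> D u v = 0.
  move=> eu ev; apply: (Dspec _ _ sp sp sp _ qt1 qt1 _ spV spV) eu ev.
    move=> a b c /inp[sa a0] /inp[sb b0] /inp[sc c0].
    by apply: Re_pos_mul; rewrite ?Re_f ?fp.
  move=> u' v' eu' ev'; apply: spV.
  by rewrite /D epsB eps_q (gpp u' v') // (gpp (q u') (q v')) // eps_q ?eu'
    ?ev'.
have Dmm u v : eps u = - u -> eps v = - v -> D u v = 0.
  move=> eu ev; apply: (Dspec _ _ sm sm sp _ qt2 qt2 _ smV smV) eu ev.
    move=> a b c /inm sa /inm sb /inp[sc c0].
    by apply: Re_pos_mul; rewrite ?Re_f ?fp.
  move=> u' v' eu' ev'; apply: spV.
  by rewrite /D epsB eps_q (gmm u' v') // (gmm (q u') (q v')) // eps_q ?eu'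
    ?ev' qN.
have Dpm u v : eps u = u -> eps v = - v -> D u v = 0.
  move=> eu ev; apply: (Dspec _ _ sp sm sm _ qt1 qt2 _ spV smV) eu ev.
    move=> a b c /inp[sa a0] /inm sb /inm sc.
    by apply: Re_pos_scale; rewrite ?Re_f ?fp.
  move=> u' v' eu' ev'; apply: smV.
  rewrite /D epsB eps_q (gpm u' v') // (gpm (q u') (q v')) ?eps_q ?eu' ?ev' ?qN
    //.
  by rewrite opprD.
have DC u v : D u v = - D v u.
  by rewrite /D lieC [lie u v]lieC /q linearN /= opprD.
have [u [u' [-> eu eu']]] := dec x; have [v [v' [-> ev ev']]] := dec y.
have DD a b c : D (a + b) c = D a c + D b c.
  by have := Dl c 1 a b; rewrite !scale1r.
have DD' a b c : D c (a + b) = D c a + D c b.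
  by have := Dr c 1 a b; rewrite !scale1r.
rewrite !DD !DD' (Dpp u v) // (Dpm u v') // (Dmm u' v') // DC Dpm //.
by rewrite oppr0 !addr0.
Qed.

End Normalize.

(** * Real forms *)

Record real_structure (R : rcfType) (V : vectLieAlgType R[i]) := RealStructure {
  rs_conj :> V -> V;
  rs_antilinear : antilinear rs_conj;
  rs_lie : lie_morph rs_conj;
  rs_involutive : involutive rs_conj
}.

Section RealForm.
Variables (R : rcfType) (V : vectLieAlgType R[i]) (s : real_structure V).
Local Notation C := R[i].
Let sL : antilinear s := rs_antilinear s.

Definition fixed_pred : {pred V} := fun x => s x == x.

Fact fixed_zmod_closed : zmod_closed fixed_pred.
Proof.
split=> [|x y]; rewrite !unfold_in ?(antilinear0 sL) ?(antilinearB sL) //.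
by move=> /eqP-> /eqP->.
Qed.
HB.instance Definition _ := GRing.isZmodClosed.Build V fixed_pred
  fixed_zmod_closed.

(** The fixed points are stable under real scalars only, so they form a subtype with its own scaling
    over [R]. *)
Record real_form := RealForm { real_form_val : V;
  _ : real_form_val \in fixed_pred }.
HB.instance Definition _ := [isSub for real_form_val].
HB.instance Definition _ := [Choice of real_form by <:].
HB.instance Definition _ := [SubChoice_isSubZmodule of real_form by <:].

Lemma real_formP (x : real_form) : s (val x) = val x.
Proof. by apply/eqP; exact: (valP x). Qed.

Fact real_form_scale_subproof (a : R) (x : real_form) :
  a%:C%C *: val x \in fixed_pred.
Proof. by rewrite unfold_in (antilinearZ sL) conjc_real real_formP. Qed.

Definition real_form_scale a x := RealForm (real_form_scale_subproof a x).

Fact real_form_scaleA a b x :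
  real_form_scale a (real_form_scale b x) = real_form_scale (a * b) x.
Proof. by apply: val_inj; rewrite /= scalerA rmorphM. Qed.
Fact real_form_scale1 : left_id 1 real_form_scale.
Proof. by move=> x; apply: val_inj; rewrite /= rmorph1 scale1r. Qed.
Fact real_form_scaleDr : right_distributive real_form_scale +%R.
Proof. by move=> a x y; apply: val_inj; rewrite /= scalerDr. Qed.
Fact real_form_scaleDl x : {morph real_form_scale^~ x : a b / a + b}.
Proof. by move=> a b; apply: val_inj; rewrite /= rmorphD scalerDl. Qed.
HB.instance Definition _ := GRing.Zmodule_isLmodule.Build R real_form
  real_form_scaleA real_form_scale1 real_form_scaleDr real_form_scaleDl.

Fact real_form_lie_subproof (x y : real_form) : lie (val x) (val y) \in
  fixed_pred.
Proof. by rewrite unfold_in rs_lie !real_formP. Qed.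
Definition real_form_lie x y := RealForm (real_form_lie_subproof x y).

Fact real_form_lie_linearl z : linear (real_form_lie^~ z).
Proof. by move=> a x y; apply: val_inj; rewrite /= lieDl lieZl. Qed.
Fact real_form_lie_linearr z : linear (real_form_lie z).
Proof. by move=> a x y; apply: val_inj; rewrite /= lieDr lieZr. Qed.
Fact real_form_liexx x : real_form_lie x x = 0.
Proof. by apply: val_inj; rewrite /= liexx. Qed.
Fact real_form_jacobi x y z :
  real_form_lie x (real_form_lie y z) + real_form_lie y (real_form_lie z x) +
  real_form_lie z (real_form_lie x y) = 0.
Proof. by apply: val_inj; rewrite /= lie_jacobi. Qed.
HB.instance Definition _ := Lmodule_isLieAlgebra.Build R real_form
  real_form_lie_linearl real_form_lie_linearr real_form_liexx real_form_jacobi.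

Local Notation I := ('i%C : C).

Definition of_complexified (u : complexification real_form) : V :=
  val u.1 + I *: val u.2.

Fact re_subproof x : 2%:R^-1 *: (x + s x) \in fixed_pred.
Proof.
rewrite unfold_in (antilinearZ sL) (antilinearD sL) rs_involutive.
by rewrite conjc_inv conjc_nat addrC.
Qed.

Fact im_subproof x : 2%:R^-1 *: (I *: (s x - x)) \in fixed_pred.
Proof.
rewrite unfold_in !(antilinearZ sL) (antilinearB sL) rs_involutive.
by rewrite conjc_inv conjc_nat conj_imag scaleNr -scalerN opprB.
Qed.

(** The real part [(x + s x) / 2] and the imaginary part [(x - s x) / (2 i)], where [1 / i] is
    written [- i]. *)
Definition complexify x : complexification real_form :=
  (RealForm (re_subproof x), RealForm (im_subproof x)).

Lemma complexifyK : cancel complexify of_complexified.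
Proof.
move=> x; rewrite /of_complexified /=.
have -> w : I *: (2%:R^-1 *: (I *: w)) = 2%:R^-1 *: - w.
  by rewrite -[- w]scaleN1r -imag_sqr !scalerA; congr (_ *: _); ring.
by rewrite -scalerDr opprB addrACA subrr addr0 half_double.
Qed.

Lemma of_complexifiedK : cancel of_complexified complexify.
Proof.
case=> x y; rewrite /of_complexified /complexify; congr pair;
  apply: val_inj => /=;
rewrite (antilinearD sL) (antilinearZ sL) conj_imag !real_formP scaleNr.
  by rewrite addrACA subrr addr0 half_double.
by rewrite opprD addrACA subrr add0r -opprD scalerN -scalerDr scalerA imag_sqr
  scaleN1r opprK half_double.
Qed.

Lemma of_complexified_linear : linear of_complexified.
Proof.
case=> a b [x y] [x' y']; rewrite /of_complexified /=.
have -> : (a +i* b)%C = a%:C%C + I * b%:C%C by simpc.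
(* With the sign written as [I * I], the remaining identity holds without using [i^2 = -1]. *)
rewrite (_ : - (b%:C%C *: _) = (I * I * b%:C%C) *: real_form_val y).
  by vring.
by rewrite imag_sqr mulN1r scaleNr.
Qed.

Lemma of_complexified_lie : lie_morph of_complexified.
Proof.
case=> x y [x' y']; rewrite /of_complexified /=.
rewrite !(lieDl, lieDr, lieZl, lieZr) !scalerA imag_sqr.
by vring.
Qed.

Lemma defined_over_reals_of : defined_over_reals V.
Proof.
exists real_form.
have cL : linear complexify.
  move=> a x y; apply: (can_inj of_complexifiedK).
  by rewrite of_complexified_linear !complexifyK.
pose cM := GRing.isLinear.Build C V (complexification real_form) _ complexify
  cL.
pose cF : {linear V -> complexification real_form} := HB.pack complexify cM.
exists cF.
split; first by exists of_complexified;
  [exact: complexifyK | exact: of_complexifiedK].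
move=> x y; apply: (can_inj of_complexifiedK).
by rewrite [RHS]of_complexified_lie !complexifyK.
Qed.

End RealForm.

(** * Isomorphisms with the conjugate algebra and antilinear automorphisms *)

Section Conj.
Variables (R : rcfType).
Local Notation C := R[i].

(** Compose with [conj_coord], an antilinear isomorphism of [conj_lie g] onto [g]. *)
Lemma antilinear_aut_of_iso (g : vectLieAlgType C) : lie_isomorphic g (conj_lie
  g) ->
  exists s : g -> g, [/\ antilinear s, lie_morph s & injective s].
Proof.
case=> f [[f' fK f'K] f_lie]; exists (fun x => conj_coord (f x)); split.
- by move=> a x y; rewrite linearP conj_coordZD.
- by move=> x y; rewrite f_lie [lie (f x) _]conj_bracketE conj_uncoordK.
- by move=> x y /(can_inj (@conj_coordK _ _))/(can_inj fK).
Qed.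

(** The conjugation of the complexification, transported to [g] and followed by the antilinear
    [conj_uncoord], is linear. *)
Lemma conj_iso_of_defined (g : vectLieAlgType C) :
  defined_over_reals g -> lie_isomorphic g (conj_lie g).
Proof.
case=> m [f [[f' fK f'K] f_lie]].
pose c (u : complexification m) : complexification m := (u.1, - u.2).
have cL : antilinear c.
  by case=> a b [x y] [x' y']; congr pair;
    rewrite /= ?opprD ?scalerN ?scaleNr ?opprK.
have cK : involutive c by case=> x y; rewrite /c /= opprK.
have c_lie : lie_morph c.
  by case=> x y [x' y']; congr pair; rewrite /= !(lieNl, lieNr) ?opprK // opprD.
have f'L a u v : f' (a *: u + v) = a *: f' u + f' v.
  by apply: (can_inj fK); rewrite linearP !f'K.
pose F x : conj_lie g := conj_uncoord (f' (c (f x))).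
have FL : linear F by move=> a x y;
  rewrite /F linearP cL f'L conj_uncoordZD conjcK.
pose FM := GRing.isLinear.Build C g (conj_lie g) _ F FL.
pose Fl : {linear g -> conj_lie g} := HB.pack F FM.
exists Fl; split.
  exists (fun u => f' (c (f (conj_coord u)))) => x; rewrite /= /F.
    by rewrite conj_uncoordK f'K cK fK.
  by rewrite f'K cK fK conj_coordK.
move=> x y; rewrite [RHS]conj_bracketE /= /F !conj_uncoordK f_lie c_lie.
by congr conj_uncoord; apply: (can_inj fK); rewrite f_lie !f'K.
Qed.
End Conj.

(** * Real structures from bases with real structure constants *)

Section RealBasis.
Variables (R : rcfType) (V : vectLieAlgType R[i]).
Implicit Types (X : seq V) (x y : V).

Fixpoint real_span X y : Prop :=
  if X is x :: X' then exists r : R, real_span X' (y - r%:C%C *: x) else y = 0.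

(** [X'] runs over the tails of [X]: by antisymmetry, brackets with later elements suffice. *)
Fixpoint real_brackets X X' : Prop :=
  if X' is x :: X'' then
    (forall y, y \in X'' -> real_span X (lie x y)) /\ real_brackets X X''
  else True.

Lemma real_span_fixed X (s : V -> V) y : antilinear s ->
  {in X, forall x, s x = x} -> real_span X y -> s y = y.
Proof.
move=> sL; elim: X y => [|x X IHX] y sX /=; first by move=> ->;
  exact: antilinear0.
have sX' : {in X, forall z, s z = z} by move=> z Xz; rewrite sX // inE Xz orbT.
case=> r /(IHX _ sX'); rewrite (antilinearB sL) (antilinearZ sL) conjc_real.
by rewrite (sX x (mem_head _ _)) => /addIr.
Qed.

Lemma real_brackets_fixed X X' (s : V -> V) : antilinear s ->
    {in X, forall x, s x = x} -> real_brackets X X' ->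
  {in X' &, forall x y, s (lie x y) = lie x y}.
Proof.
move=> sL sX; elim: X' => [|x X' IH] //= [xX' {}/IH IH] y z.
have sxX' u : u \in X' -> s (lie x u) = lie x u.
  by move=> /xX'; exact: real_span_fixed.
rewrite !inE => /predU1P[-> | X'y] /predU1P[-> | X'z].
- by rewrite liexx antilinear0.
- exact: sxX'.
- by rewrite lieC antilinearN // sxX'.
- exact: IH.
Qed.

(** The real structure conjugates the coordinates in [X]. It fixes the elements of [X] and, their
    real combinations being fixed, also their brackets. *)
Lemma real_structure_of_basis X : basis_of {:V} X -> real_brackets X X ->
  inhabited (real_structure V).
Proof.
move=> bX rX; pose T := in_tuple X; have bT : basis_of {:V} T by [].
have xE x := coord_basis bT (memvf x).
pose s x := \sum_i (coord T i x)^*%C *: T`_i.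
have sL : antilinear s.
  move=> a x y; rewrite /s scaler_sumr -big_split; apply: eq_bigr => i _ /=.
  by rewrite linearP rmorphD rmorphM scalerDl scalerA.
have sX : {in X, forall x, s x = x}.
  move=> x /(nthP 0)[i iX <-].
  have -> : X`_i = T`_(Ordinal iX) by [].
  rewrite /s (bigD1 (Ordinal iX)) // big1 => [|j ji].
    by rewrite coord_free ?(basis_free bT) // eqxx conjc1 scale1r [LHS]addr0.
  by rewrite coord_free ?(basis_free bT) // eq_sym (negPf ji) conjc0 scale0r.
have sK : involutive s.
  move=> x; rewrite {2}/s (antilinear_sum sL) [RHS]xE; apply: eq_bigr => i _.
  by rewrite (antilinearZ sL) conjcK sX // mem_nth.
have s_lie : lie_morph s.
  move=> x y; rewrite {1}(xE x) {1}(xE y) lie_suml (antilinear_sum sL) [in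
    RHS]/s.
  rewrite [RHS]lie_suml; apply: eq_bigr => i _.
  rewrite !lie_sumr (antilinear_sum sL); apply: eq_bigr => j _.
  rewrite !(lieZl, lieZr) !(antilinearZ sL); congr (_ *: (_ *: _)).
  by apply: (real_brackets_fixed sL sX rX); rewrite mem_nth.
exact: inhabits (RealStructure sL s_lie sK).
Qed.

End RealBasis.

Lemma eigenvector_in (K : closedFieldType) (V : vectType K) (t : {linear V ->
  V})
    (W : {vspace V}) : (forall x, x \in W -> t x \in W) -> W != 0%VS ->
  exists z x, [/\ x \in W, x != 0 & t x = z *: x].
Proof.
rewrite -vpick0 => tW W0; have [s sV] := pact_annihilator t.
have [z [p [tp p0]]] := pact_root_eigenvector W0 (sV _).
exists z, (pact t p (vpick W)); split=> //.
elim/poly_ind: p {tp p0} => [|p c IHp]; first by rewrite pact0 mem0v.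
by rewrite pactD pactMX pactC memvD ?memvZ ?memv_pick //; apply: tW.
Qed.

(** * Quaternionic odd part *)

Section Quaternionic.
Variables (R : rcfType) (V : vectLieAlgType R[i]) (s : V -> V).
Local Notation C := R[i].
Hypotheses (sL : antilinear s) (s_lie : lie_morph s).
Local Notation I := ('i%C : C).

Section Fixed.
Variable W : {vspace V}.
Hypotheses (sW : forall x, x \in W -> s x \in W)
  (sK : forall x, x \in W -> s (s x) = x).

(** A vector [u] outside [U] is [(b1 - i b2) / 2] with [b1] and [b2] fixed by [s], so one of them is
    outside [U]. *)
Lemma fixed_notin (U : {vspace V}) : ~~ (W <= U)%VS ->
  exists b, [/\ b \in W, s b = b & b \notin U].
Proof.
case/subvPn=> u Wu Uu; pose b1 := u + s u; pose b2 := I *: (u - s u).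
have Wb1 : b1 \in W by rewrite memvD ?sW.
have Wb2 : b2 \in W by rewrite memvZ // memvB ?sW.
have [Ub1 | Ub1] := boolP (b1 \in U); last first.
  by exists b1; split=> //; rewrite (antilinearD sL) sK // addrC.
exists b2; split=> //.
  rewrite (antilinearZ sL) (antilinearB sL) sK // conj_imag.
  by rewrite scaleNr -scalerN opprB.
apply: contra Uu => Ub2.
have -> : u = 2%:R^-1 *: (b1 - I *: b2).
  rewrite /b2 scalerA imag_sqr; apply: vcoordP => i; rewrite ?vcoordE.
  by field.
by rewrite memvZ // memvB // memvZ.
Qed.

Lemma fixed_extend c : c \in W -> c != 0 -> (\dim W <= 2)%N ->
  basis_of W [:: c] \/ exists b, [/\ b \in W, s b = b & basis_of W [:: c; b]].
Proof.
move=> Wc c0 dW; have [Wle | /fixed_notin[b [Wb sb cb]]] := boolP (W <=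
  <[c]>)%VS.
  by left; rewrite basisEdim span_seq1 Wle /= lt0n dimv_eq0 -subv0;
    apply: contra c0 => W0; rewrite -memv0 (subvP W0).
right; exists b; split=> //; rewrite basisEfree.
rewrite (@perm_free _ _ _ [:: b; c]) ?(perm_catC [:: c] [:: b]) // free_cons.
rewrite span_seq1 cb seq1_free c0 /= dW andbT; apply/span_subvP => x.
by rewrite !inE => /orP[] /eqP->.
Qed.

Lemma fixed_basis : (\dim W <= 2)%N -> exists B : seq V,
  [/\ basis_of W B, {in B, forall x, s x = x} & (size B <= 2)%N].
Proof.
have [W0 | Wn0] := boolP (W <= 0)%VS => dW.
  by exists [::]; split=> //; rewrite (_ : W = 0%VS) ?nil_basis //; apply/eqP;
    rewrite -subv0.
have [c [Wc sc]] := fixed_notin Wn0; rewrite memv0 => c0.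
have [bc | [b [Wb sb bcb]]] := fixed_extend Wc c0 dW.
  by exists [:: c]; split=> // x; rewrite inE => /eqP->.
by exists [:: c; b]; split=> // x; rewrite !inE => /orP[] /eqP->.
Qed.

End Fixed.

(** If [s v = a v], then [s (s v)] is [|a|^2 v], which cannot be [- v]. *)
Lemma quaternionic_free v : s (s v) = - v -> v != 0 -> free [:: s v; v].
Proof.
move=> ssv v0; rewrite free_cons seq1_free v0 andbT span_seq1.
apply/negP => /vlineP[a sv]; have := ssv;
  rewrite sv (antilinearZ sL) sv scalerA.
move/eqP; rewrite -subr_eq0 opprK -[X in _ + X]scale1r -scalerDl scaler_eq0
  (negPf v0) orbF.
by rewrite mulrC gt_eqF // ltr_wpDl // mulcJ_ge0.
Qed.

Hypothesis s4 : forall x, s (s (s (s x))) = x.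
Variables Vp Vm : {vspace V}.
Hypotheses (memVp : forall x, (x \in Vp) = (s (s x) == x))
  (memVm : forall x, (x \in Vm) = (s (s x) == - x))
  (dVp : (\dim Vp <= 2)%N) (dVm : \dim Vm = 2%N).

Lemma Vp_conj x : x \in Vp -> s x \in Vp.
Proof. by rewrite !memVp => /eqP->. Qed.

Lemma Vp_conjK x : x \in Vp -> s (s x) = x.
Proof. by rewrite memVp => /eqP. Qed.

Lemma Vm_conj x : x \in Vm -> s x \in Vm.
Proof. by rewrite !memVm => /eqP->; rewrite (antilinearN sL). Qed.

Lemma Vm_conjK x : x \in Vm -> s (s x) = - x.
Proof. by rewrite memVm => /eqP. Qed.

Lemma lie_VpVm x y : x \in Vp -> y \in Vm -> lie x y \in Vm.
Proof.
by move=> /Vp_conjK xp /Vm_conjK ym; rewrite memVm !s_lie xp ym lieNr.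
Qed.

Lemma lie_VpVp x y : x \in Vp -> y \in Vp -> lie x y \in Vp.
Proof. by move=> /Vp_conjK xp /Vp_conjK yp; rewrite memVp !s_lie xp yp. Qed.

Lemma Vm_basis v : v \in Vm -> v != 0 -> basis_of Vm [:: s v; v].
Proof.
move=> Vv v0; rewrite basisEfree quaternionic_free ?Vm_conjK //= dVm leqnn
  andbT.
by apply/span_subvP => x; rewrite !inE => /orP[] /eqP->; rewrite ?Vm_conj.
Qed.

Lemma Vm_coords v x : v \in Vm -> v != 0 -> x \in Vm ->
  exists a b, x = a *: v + b *: s v.
Proof.
move=> Vv v0; rewrite -(span_basis (Vm_basis Vv v0)) span_cons span_seq1.
case/memv_addP=> _ /vlineP[b ->] [_ /vlineP[a ->] ->]; exists a, b.
by rewrite addrC.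
Qed.

Lemma Vm_indep v a b : v \in Vm -> v != 0 -> a *: v + b *: s v = 0 -> b = 0.
Proof.
move=> Vv v0 ab; have := quaternionic_free (Vm_conjK Vv) v0.
rewrite free_cons span_seq1 => /andP[/negP sv _]; apply/eqP/negPn/negP => b0.
case: sv; apply/vlineP; exists (- (b^-1 * a)).
rewrite scaleNr -scalerA; apply/eqP; rewrite -addr_eq0 addrC.
by rewrite -[s v in X in _ + X](scalerK b0) -scalerDr ab scaler0.
Qed.

Lemma fullv_basis B B' : basis_of Vp B -> basis_of Vm B' -> basis_of {:V} (B ++
  B').
Proof.
move=> bB bB'; suff -> : fullv = (Vp + Vm)%VS.
  apply: cat_basis => //; apply/directv_addP/eqP; rewrite -subv0;
    apply/subvP => x.
  rewrite memv_cap memVp memVm memv0 => /andP[/eqP-> /eqP xx].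
  by rewrite -[x](half_double) {2}xx subrr scaler0.
apply/eqP; rewrite eqEsubv subvf andbT; apply/subvP => x _.
rewrite (half_sum_diff x (s (s x))) memv_add ?memvZ //.
  by rewrite memVp !(antilinearD sL) s4 addrC.
by rewrite memVm !(antilinearB sL) s4 opprB.
Qed.

Lemma ad_eigenvector x : x \in Vp -> exists z v, [/\ v \in Vm, v != 0 & lie x v
  = z *: v].
Proof.
move=> Vx; apply: (@eigenvector_in _ _ (lie x)); first by move=> y;
  exact: lie_VpVm.
by rewrite -dimv_eq0 dVm.
Qed.

Lemma lie_lie (x y z : V) : lie (lie x y) z = lie x (lie y z) - lie y (lie x z).
Proof.
have /eqP := lie_jacobi x y z;
  rewrite [lie z (lie x y)]lieC subr_eq0 => /eqP <-.
by rewrite [lie z x]lieC lieNr.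
Qed.

Lemma lie_conj x v z : s x = x -> lie x v = z *: v -> lie x (s v) = z^*%C *: s
  v.
Proof. by move=> sx xv; rewrite -[in LHS]sx -s_lie xv (antilinearZ sL). Qed.

(** Averaging an expansion of [x] with its image under [s] replaces the coefficients by their real
    parts. *)
Lemma real_coords c b x : s c = c -> s b = b -> s x = x -> x \in <<[:: c;
  b]>>%VS ->
  exists p q : R, x = p%:C%C *: c + q%:C%C *: b.
Proof.
move=> sc sb sx; rewrite span_cons span_seq1.
case/memv_addP=> _ /vlineP[p ->] [_ /vlineP[q ->] xE].
exists (complex.Re p), (complex.Re q).
have := sx; rewrite {1}xE (antilinearD sL) !(antilinearZ sL) sc sb => xE'.
have -> : x = 2%:R^-1 *: (x + x).
  by apply: vcoordP => i; rewrite ?vcoordE; field.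
by rewrite {1}xE -{1}xE' !ReJ_add; apply: vcoordP => i; rewrite ?vcoordE; field.
Qed.

(* [Vp] acts on the quaternionic line [Vm] through a commutative algebra. *)
Lemma common_eigenvector : exists v, [/\ v \in Vm, v != 0 &
  forall x, x \in Vp -> exists z, lie x v = z *: v].
Proof.
suff [c [b [sc sb VpE v]]] : exists c b, [/\ s c = c, s b = b, Vp = <<[:: c;
  b]>>%VS &
    exists v, [/\ v \in Vm, v != 0, exists z, lie c v = z *: v & exists z, lie
      b v = z *: v]].
  case: v => v [Vv v0 [z cv] [t bv]]; exists v; split=> // x.
  rewrite VpE span_cons span_seq1.
  case/memv_addP=> _ /vlineP[p ->] [_ /vlineP[q ->] ->]; exists (p * z + q * t).
  by rewrite lieDl !lieZl cv bv; vring.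
have [B [bB sB zB]] := fixed_basis Vp_conj Vp_conjK dVp.
have [c [b [sc sb VpE]]] : exists c b, [/\ s c = c, s b = b & Vp = <<[:: c;
  b]>>%VS].
  have s0 := antilinear0 sL; rewrite -(span_basis bB).
  case: B bB sB zB => [|c [|b [|//]]] bB sB _.
  - by exists 0, 0; split; rewrite // !span_cons !span_nil !addv0.
  - exists c, 0; split=> //; first by rewrite sB ?mem_head.
    by rewrite !span_cons span_nil !addv0.
  - by exists c, b; split; rewrite ?sB ?inE ?eqxx ?orbT.
exists c, b; split=> //.
have [Vc Vb] : c \in Vp /\ b \in Vp.
  by rewrite VpE !memv_span ?inE ?eqxx ?orbT.
have [m [x [Vx x0 bx]]] := ad_eigenvector Vb.
have bsx := lie_conj sb bx.
have [al [be cx]] := Vm_coords Vx x0 (lie_VpVm Vc Vx).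
have [p [q cb]] : exists p q : R, lie c b = p%:C%C *: c + q%:C%C *: b.
  by apply: real_coords; rewrite // ?s_lie ?sc ?sb // -VpE lie_VpVp.
have [be0 | ben0] := eqVneq be 0.
  by exists x; split=> //; [exists al; rewrite cx be0 scale0r addr0 | exists m].
(* The coefficient of [s x] in [[[c, b], x]] gives [p + m^*%C = m]; as [p] is real, so is [m]. *)
have mm : m^*%C = m.
  have := lie_lie c b x; rewrite cb lieDl !lieZl cx bx lieZr lieDr !lieZr cx bx
    bsx.
  move/eqP; rewrite -subr_eq0 => /eqP jac.
  have : be * (p%:C%C + m^*%C - m) = 0.
    apply: (@Vm_indep x (p%:C%C * al + q%:C%C * m)) => //.
    by rewrite -[RHS]jac; vring.
  move/eqP; rewrite mulf_eq0 (negPf ben0) /= subr_eq0 => /eqP.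
  case: (m) => m1 m2 /eqP; rewrite eq_complex /= => /andP[_ /eqP].
  by rewrite add0r => ->.
have [z [v [Vv v0 cv]]] := ad_eigenvector Vc.
exists v; split=> //; first by exists z.
(* [b] has the eigenvalue [m] on both [x] and [s x], so it is scalar on [Vm] and any eigenvector of
   [c] serves. *)
exists m; have [a1 [a2 ->]] := Vm_coords Vx x0 Vv.
by rewrite lieDr !lieZr bx bsx mm; vring.
Qed.

Lemma Vm_basis2 v a b : v \in Vm -> v != 0 ->
  v \in <<[:: a; b]>>%VS -> s v \in <<[:: a; b]>>%VS -> basis_of Vm [:: a; b].
Proof.
move=> Vv v0 abv absv; rewrite basisEdim dVm andbT -(span_basis (Vm_basis Vv
  v0)).
by apply/span_subvP => x; rewrite !inE => /orP[] /eqP->.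
Qed.

Lemma mem_span2 (a b : V) p q : p *: a + q *: b \in <<[:: a; b]>>%VS.
Proof. by rewrite memvD // memvZ // memv_span // !inE eqxx ?orbT. Qed.

(** * Real bases built on a common eigenvector *)

Section Assemble.
Variable v : V.
Hypotheses (Vv : v \in Vm) (v0 : v != 0)
  (Vpv : forall x, x \in Vp -> exists z, lie x v = z *: v).

Let w := s v.
(** A fixed [x] in [Vp] is diagonal on [v], [w] with conjugate eigenvalues; on [v1], [v2] it becomes
    the real matrix of multiplication by a complex number. *)
Let v1 := v + w.
Let v2 := I *: (v - w).
Let c := lie v w.

Lemma bracket_fixed : s c = c.
Proof. by rewrite /c s_lie /w Vm_conjK // lieNr lieC opprK. Qed.

Lemma bracket_Vp : c \in Vp.
Proof. by rewrite memVp !bracket_fixed. Qed.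

Lemma basis_v1v2 : basis_of Vm [:: v1; v2].
Proof.
apply: Vm_basis2 Vv v0 _ _.
  rewrite (_ : v = 2%:R^-1 *: v1 + (- 2%:R^-1 * I) *: v2) ?mem_span2 //.
  rewrite /v2 scalerA -mulrA imag_sqr /v1; apply: vcoordP => i;
    rewrite ?vcoordE.
  by field.
rewrite (_ : s v = 2%:R^-1 *: v1 + (2%:R^-1 * I) *: v2) ?mem_span2 //.
rewrite /v2 scalerA -mulrA imag_sqr /v1 -/w; apply: vcoordP => i;
  rewrite ?vcoordE.
by field.
Qed.

Lemma basis_vw : basis_of Vm [:: v; I *: w].
Proof.
apply: Vm_basis2 Vv v0 _ _; first by rewrite memv_span ?mem_head.
rewrite (_ : s v = 0 *: v + (- I) *: (I *: w)) ?mem_span2 //.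
by rewrite scalerA mulNr imag_sqr opprK scale1r scale0r add0r.
Qed.

Lemma lie_v1v2 : lie v1 v2 = - 2%:R *: (I *: c).
Proof.
rewrite /v1 /v2 lieZr lieDr lieNr !lieDl !liexx [lie w v]lieC -/c.
by vring.
Qed.

Lemma lie_x_v1v2 x : x \in Vp -> s x = x -> exists p q : R,
  [/\ lie x v1 = p%:C%C *: v1 + q%:C%C *: v2,
      lie x v2 = p%:C%C *: v2 - q%:C%C *: v1 &
      lie x c = (2%:R * p%:C%C) *: c].
Proof.
move=> Vx sx; have [z xv] := Vpv Vx; have xw := lie_conj sx xv.
exists (complex.Re z), (complex.Im z); split.
- rewrite /v1 /v2 lieDr xv xw complex_conj_parts {1}(complex_parts z).
  by vring.
- rewrite /v1 /v2 lieZr lieDr lieNr xv xw complex_conj_parts {1}(complex_parts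
  z).
  have -> : (complex.Im z)%:C%C *: (v + w) = (- (I * I) * (complex.Im z)%:C%C)
    *: (v + w).
    by rewrite imag_sqr opprK mul1r.
  by vring.
- have := lie_lie x v w; rewrite /c xv lieZl => /eqP.
  rewrite eq_sym subr_eq -/w xw lieZr => /eqP ->.
  by rewrite -scalerDl addcJ.
Qed.

(** Here [v1] and [v2] commute, and brackets of fixed vectors of [Vp] are fixed, so a fixed basis of
    [Vp] completed by [v1], [v2] is real. *)
Lemma assemble0 : c = 0 -> inhabited (real_structure V).
Proof.
move=> c0; have v12 : lie v1 v2 = 0 by rewrite lie_v1v2 c0 !scaler0.
have [B [bB sB zB]] := fixed_basis Vp_conj Vp_conjK dVp.
apply: (real_structure_of_basis (fullv_basis bB basis_v1v2)).
have VB x : x \in B -> x \in Vp by exact: basis_mem bB.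
case: B bB sB zB VB => [|a [|b [|//]]] bB sB _ VB /=.
- split=> // y; rewrite !inE => /eqP->; exists 0, 0.
  by rewrite v12; vring.
- have [p [q [av1 av2 _]]] := lie_x_v1v2 (VB a (mem_head _ _)) (sB a (mem_head
  _ _)).
  split.
    move=> y; rewrite !inE => /orP[] /eqP->.
      by exists 0, p, q; rewrite av1; vring.
    by exists 0, (- q), p; rewrite av2 rmorphN; vring.
  split=> // y; rewrite !inE => /eqP->; exists 0, 0, 0.
  by rewrite v12; vring.
have [aB bB'] : a \in [:: a; b] /\ b \in [:: a; b] by rewrite !inE !eqxx orbT.
have [p [q [av1 av2 _]]] := lie_x_v1v2 (VB a aB) (sB a aB).
have [p' [q' [bv1 bv2 _]]] := lie_x_v1v2 (VB b bB') (sB b bB').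
have [m [n ab]] : exists m n : R, lie a b = m%:C%C *: a + n%:C%C *: b.
  apply: real_coords; rewrite ?s_lie ?sB //.
  by rewrite (span_basis bB) lie_VpVp // VB.
split.
  move=> y; rewrite !inE => /or3P[] /eqP->.
  - by exists m, n, 0, 0; rewrite ab; vring.
  - by exists 0, 0, p, q; rewrite av1; vring.
  - by exists 0, 0, (- q), p; rewrite av2 rmorphN; vring.
split.
  move=> y; rewrite !inE => /orP[] /eqP->.
    by exists 0, 0, p', q'; rewrite bv1; vring.
  by exists 0, 0, (- q'), p'; rewrite bv2 rmorphN; vring.
split=> // y; rewrite !inE => /eqP->; exists 0, 0, 0, 0.
by rewrite v12; vring.
Qed.

Hypothesis c0 : c != 0.

(** The derivation [lie c] kills [c = [v, w]], on which it acts by [z + z^*%C]. *)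
Lemma bracket_weight z : lie c v = z *: v -> z^*%C = - z.
Proof.
move=> cv; have cw := lie_conj bracket_fixed cv.
have := lie_lie c v w; rewrite cv lieZl -/c liexx cw lieZr -/c sub0r => /eqP.
rewrite -subr_eq0 opprK -scalerDl scaler_eq0 (negPf c0) orbF addrC addr_eq0.
by move/eqP.
Qed.

(** [i c] replaces [c] because [lie v1 v2] and [lie v (I *: w)] are real multiples of [i c]. The
    shift by [a *: c] serves to make [b] central in [assemble_sl2]. *)
Lemma basis_Ic b : basis_of Vp [:: c; b] -> forall a,
  basis_of Vp [:: I *: c; b + a *: c].
Proof.
move=> bcb a; rewrite basisEdim (size_basis (X := [tuple c;
  b]) bcb) leqnn andbT.
rewrite -(span_basis bcb).
have cE : c = (- I) *: (I *: c) + 0 *: (b + a *: c).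
  by rewrite scalerA mulNr imag_sqr opprK scale1r scale0r addr0.
have bE : b = (a * I) *: (I *: c) + 1 *: (b + a *: c).
  by rewrite scalerA -mulrA imag_sqr; vring.
have := mem_span2 (I *: c) (b + a *: c) (- I) 0; rewrite -cE => cS.
have := mem_span2 (I *: c) (b + a *: c) (a * I) 1; rewrite -bE => bS.
by apply/span_subvP => x; rewrite !inE => /orP[] /eqP->.
Qed.

Lemma basis_Ic1 : basis_of Vp [:: c] -> basis_of Vp [:: I *: c].
Proof.
move=> bc; rewrite basisEdim -(span_basis bc) !span_seq1 dim_vline c0 andbT.
rewrite -memvE; apply/vlineP; exists (- I).
by rewrite scalerA mulNr imag_sqr opprK scale1r.
Qed.

(** [c] kills [v1] and [v2], and a fixed [b] scales [c] by a real number, so [i c], [v1], [v2], with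
    [b] added when [Vp] is a plane, form a real basis. *)
Lemma assemble_nil : lie c v = 0 -> inhabited (real_structure V).
Proof.
move=> cv; have cw : lie c w = 0.
  have := lie_conj bracket_fixed (z := 0) (v := v); rewrite cv !scale0r.
  by rewrite conjc0 scale0r; apply.
have cv12 : lie c v1 = 0 /\ lie c v2 = 0.
  by rewrite /v1 /v2 lieZr !(lieDr, lieNr) cv cw oppr0 addr0 scaler0.
have [cv1 cv2] := cv12.
have [bc | [b [Vb sb bcb]]] := fixed_extend Vp_conj Vp_conjK bracket_Vp c0 dVp.
  apply: (real_structure_of_basis (fullv_basis (basis_Ic1 bc) basis_v1v2)) =>
    /=.
  split.
    move=> y; rewrite !inE => /orP[] /eqP->; exists 0, 0, 0.
      by rewrite lieZl cv1; vring.
    by rewrite lieZl cv2; vring.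
  split=> // y; rewrite !inE => /eqP->; exists (- 2%:R), 0, 0.
  by rewrite lie_v1v2 rmorphN rmorph_nat; vring.
have [p [q [bv1 bv2 bc]]] := lie_x_v1v2 Vb sb.
have := fullv_basis (basis_Ic bcb 0) basis_v1v2; rewrite scale0r addr0 => bV.
apply: (real_structure_of_basis bV) => /=.
split.
  move=> y; rewrite !inE => /or3P[] /eqP->.
  - exists (- (2%:R * p)), 0, 0, 0.
    by rewrite lieZl lieC bc rmorphN rmorphM rmorph_nat; vring.
  - by exists 0, 0, 0, 0; rewrite lieZl cv1; vring.
  - by exists 0, 0, 0, 0; rewrite lieZl cv2; vring.
split.
  move=> y; rewrite !inE => /orP[] /eqP->.
    by exists 0, 0, p, q; rewrite bv1; vring.
  by exists 0, 0, (- q), p; rewrite bv2 rmorphN; vring.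
split=> // y; rewrite !inE => /eqP->; exists (- 2%:R), 0, 0, 0.
by rewrite lie_v1v2 rmorphN rmorph_nat; vring.
Qed.

(** As [z = n i], the vector [i c] has the real weights [-n] and [n] on [v] and [i w], and [[v, i w]
    = i c]: a split copy of sl2. When [Vp] is a plane, a central vector completes the basis. *)
Lemma assemble_sl2 z : lie c v = z *: v -> z != 0 -> inhabited (real_structure
  V).
Proof.
move=> cv z0; have zJ := bracket_weight cv.
have cw := lie_conj bracket_fixed cv.
have {}cw : lie c w = - z *: w by rewrite cw zJ.
have [n zE] : exists n : R, z = n%:C%C * I.
  exists (complex.Im z); rewrite {1}(complex_parts z).
  case: (z) zJ => a b /eqP; rewrite eq_complex /= => /andP[/eqP aN _].
  have -> : a = 0.
    by apply/eqP; move/eqP: aN; rewrite -addr_eq0 -mulr2n mulrn_eq0.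
  by rewrite rmorph0 add0r.
have Icv : lie (I *: c) v = - n%:C%C *: v.
  by rewrite lieZl cv zE scalerA mulrCA imag_sqr mulrN1.
have Icw : lie (I *: c) (I *: w) = n%:C%C *: (I *: w).
  rewrite lieZl lieZr cw zE !scalerA; congr (_ *: _).
  transitivity (- (I * I) * (n%:C%C * I)); first by ring.
  by rewrite imag_sqr opprK mul1r.
have vIw : lie v (I *: w) = I *: c by rewrite lieZr.
have [bc | [b [Vb sb bcb]]] := fixed_extend Vp_conj Vp_conjK bracket_Vp c0 dVp.
  apply: (real_structure_of_basis (fullv_basis (basis_Ic1 bc) basis_vw)) => /=.
  split.
    move=> y; rewrite !inE => /orP[] /eqP->.
      by exists 0, (- n), 0; rewrite Icv rmorphN; vring.
    by exists 0, 0, n; rewrite Icw; vring.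
  split=> // y; rewrite !inE => /eqP->; exists 1, 0, 0.
  by rewrite vIw rmorph1; vring.
have [t bv] := Vpv Vb; have bw := lie_conj sb bv.
have bc : lie b c = (t + t^*%C) *: c.
  have := lie_lie b v w; rewrite -/c bv lieZl -/c bw lieZr -/c => /eqP.
  by rewrite eq_sym subr_eq -scalerDl => /eqP.
(* [b] and [c] act on [v] by scalars, so [[b, c]] kills [v]; it also acts on it by [t + t^*%C] times
   [z]. *)
have t0 : t + t^*%C = 0.
  have := lie_lie b c v; rewrite bc lieZl cv bv !lieZr cv bv => /eqP.
  rewrite !scalerA [t * z]mulrC subrr scaler_eq0 (negPf v0) orbF mulf_eq0.
  by rewrite (negPf z0) orbF => /eqP.
have tJ : t^*%C = - t by apply/eqP; rewrite -addr_eq0 addrC t0.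
(* Both [t] and [z] are opposite to their conjugates, so the shift that cancels the action on [v]
   also cancels the one on [w]. *)
pose b' := b + (- (t / z)) *: c.
have b'v : lie b' v = 0.
  by rewrite /b' lieDl lieZl bv cv scalerA mulNr divfK // scaleNr subrr.
have b'w : lie b' w = 0.
  rewrite /b' lieDl lieZl cw bw tJ scalerA mulrNN divfK //.
  by rewrite -scalerDl addNr scale0r.
have b'c : lie b' c = 0.
  by rewrite /b' lieDl lieZl liexx bc t0 scale0r scaler0 addr0.
apply: (real_structure_of_basis (fullv_basis (basis_Ic bcb (- (t / z)))
  basis_vw)).
rewrite -/b' /=; split.
  move=> y; rewrite !inE => /or3P[] /eqP->.
  - by exists 0, 0, 0, 0; rewrite lieZl lieC b'c; vring.
  - by exists 0, 0, (- n), 0; rewrite Icv rmorphN; vring.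
  - by exists 0, 0, 0, n; rewrite Icw; vring.
split.
  move=> y; rewrite !inE => /orP[] /eqP->; exists 0, 0, 0, 0.
    by rewrite b'v; vring.
  by rewrite lieZr b'w; vring.
split=> // y; rewrite !inE => /eqP->; exists 1, 0, 0, 0.
by rewrite vIw rmorph1; vring.
Qed.

End Assemble.
Lemma quaternionic_real_structure : inhabited (real_structure V).
Proof.
have [v [Vv v0 Vpv]] := common_eigenvector.
have [c0 | c0] := eqVneq (lie v (s v)) 0; first exact: assemble0 c0.
have [z cv] := Vpv _ (bracket_Vp Vv).
have [z0 | z0] := eqVneq z 0; last exact: assemble_sl2 cv z0.
by apply: (assemble_nil Vv) => //; rewrite cv z0 scale0r.
Qed.

End Quaternionic.

(** * Antilinear automorphisms without odd-dimensional stable subspaces *)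

Section Spaces.
Variables (K : fieldType) (V : vectType K).
Implicit Types (U W : {vspace V}) (x y : V).

Lemma dim_line_le x : (\dim <[x]> <= 1)%N.
Proof. by rewrite dim_vline leq_b1. Qed.

Lemma dim_add_line W x : x \notin W -> \dim (W + <[x]>) = (\dim W).+1.
Proof.
move=> Wx; have x0 : x != 0 by apply: contraNneq Wx => ->; exact: mem0v.
rewrite dimv_disjoint_sum ?dim_vline ?x0 ?addn1 //.
apply/eqP; rewrite -subv0; apply/subvP => y; rewrite memv_cap memv0.
case/andP=> Wy /vlineP[k yE]; rewrite yE; have [-> | k0] := eqVneq k 0.
  by rewrite scale0r.
by case/negP: Wx; rewrite -(scalerK k0 x) memvZ // -yE.
Qed.

Lemma dim_add_line_le W x : (\dim (W + <[x]>) <= (\dim W).+1)%N.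
Proof.
have := dimv_sum_cap W <[x]>; have := dim_line_le x; lia.
Qed.

Lemma plane_span W : (\dim W <= 2)%N -> exists x y, W = (<[x]> + <[y]>)%VS.
Proof.
have := span_basis (vbasisP W); have := size_tuple (vbasis W).
case: (tval (vbasis W)) => [|x [|y [|? ?]]] //=.
- by move=> _ <- _; exists 0, 0; rewrite addvv span_nil.
- by move=> _ <- _; exists x, 0; rewrite span_seq1 addv0.
- by move=> _ <- _; exists x, y; rewrite span_cons span_seq1.
by move=> <-.
Qed.

Lemma complement_span U : (\dim {:V} <= \dim U + 2)%N ->
  exists x y, (fullv = U + (<[x]> + <[y]>))%VS.
Proof.
move=> dU; have [|x [y Uxy]] := @plane_span (U^C)%VS;
  first by rewrite dimv_compl; lia.
by exists x, y; rewrite -Uxy addv_complf.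
Qed.

Lemma plane_indep x y p q : \dim (<[x]> + <[y]>) = 2%N -> p *: x + q *: y = 0 ->
  p = 0 /\ q = 0.
Proof.
move=> dxy pq.
have hp (a b : V) (k l : K) : \dim (<[a]> + <[b]>) = 2%N -> k *: a + l *: b = 0
  -> k = 0.
  move=> dab kl; apply/eqP/negPn/negP => k0.
  have ab : (<[a]> <= <[b]>)%VS.
    rewrite -memvE -(scalerK k0 a) memvZ //; move/eqP: kl;
      rewrite addr_eq0 => /eqP->.
    by rewrite -scaleNr memvZ // memv_line.
  by move: dab; rewrite (addv_idPr ab); have := dim_line_le b; lia.
split; first exact: hp pq.
by apply: (@hp y x q p); rewrite 1?addvC // addrC.
Qed.

Lemma plane_memP x y z : z \in (<[x]> + <[y]>)%VS -> exists p q, z = p *: x + q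
  *: y.
Proof. by case/memv_addP=> _ /vlineP[p ->] [_ /vlineP[q ->] ->];
  exists p, q. Qed.

End Spaces.

(** * Brackets of subspaces *)

Section Brackets.
Variables (K : fieldType) (V : vectLieAlgType K).
Implicit Types (U W Z : {vspace V}) (x y : V).

Definition brk U W : {vspace V} :=
  <<[seq lie x y | x <- vbasis U, y <- vbasis W]>>%VS.

Lemma mem_brk U W x y : x \in U -> y \in W -> lie x y \in brk U W.
Proof.
move=> Ux Wy; rewrite (coord_vbasis Ux) (coord_vbasis Wy) lie_suml memv_suml //
  => i _.
rewrite lie_sumr memv_suml // => j _;
  rewrite lieZl lieZr !memvZ // memv_span //.
by apply: allpairs_f; apply: mem_nth; rewrite size_tuple.
Qed.

Lemma brk_sub U W Z : {in U & W, forall x y, lie x y \in Z} -> (brk U W <=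
  Z)%VS.
Proof.
move=> UWZ; apply/span_subvP => _ /allpairsP[[x y] /= [Ux Wy ->]].
by apply: UWZ; apply: vbasis_mem.
Qed.

(** The bracket factors through the exterior square of the plane; the coefficient is a
    determinant. *)
Lemma brk_plane U x y : U = (<[x]> + <[y]>)%VS -> (brk U U <= <[lie x y]>)%VS.
Proof.
move=> UE; apply: brk_sub => a b; rewrite UE.
move=> /plane_memP[p [q ->]] /plane_memP[r [t ->]].
apply/vlineP; exists (p * t - q * r).
rewrite !(lieDl, lieDr, lieZl, lieZr) !liexx [lie y x]lieC.
by vring.
Qed.

End Brackets.

(** * Stable subspaces and the derived algebra *)

Section NoOddSubspace.
Variables (R : rcfType) (V : vectLieAlgType R[i]) (s : V -> V).
Local Notation C := R[i].
Hypotheses (sL : antilinear s) (s_lie : lie_morph s) (s_inj : injective s).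
Implicit Types (U W Z : {vspace V}) (x y : V).

Definition stable W := forall x, x \in W -> s x \in W.

Lemma span_stable (X : seq V) : {in X, forall x, s x \in <<X>>%VS} -> stable
  <<X>>%VS.
Proof.
move=> sX x /(@coord_span _ _ _ (in_tuple X)) ->; rewrite (antilinear_sum sL).
by apply: memv_suml => i _; rewrite (antilinearZ sL) memvZ // sX // mem_nth.
Qed.

Lemma brk_stable U W : stable U -> stable W -> stable (brk U W).
Proof.
move=> sU sW; apply: span_stable => _ /allpairsP[[x y] /= [Ux Wy ->]].
by rewrite s_lie -/(brk U W) mem_brk ?sU ?sW ?vbasis_mem.
Qed.

Lemma stable_full : stable fullv.
Proof. by move=> x _; exact: memvf. Qed.

Lemma stable_eigenvector W : stable W -> W != 0%VS ->
  exists z x, [/\ x \in W, x != 0, z != 0 & s (s x) = z *: x].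
Proof.
move=> sW W0.
pose ss x := s (s x).
have ssL : linear ss by move=> a x y; rewrite /ss !sL conjcK.
pose ssM := GRing.isLinear.Build C V V _ ss ssL.
pose s2 : {linear V -> V} := HB.pack ss ssM.
have [|z [x [Wx x0 sx]]] := @eigenvector_in _ _ s2 W _ W0.
  by move=> x Wx; apply/sW/sW.
exists z, x; split=> //; apply: contraNneq x0 => z0; move: sx;
  rewrite z0 scale0r.
move=> sx; apply/eqP/s_inj/s_inj; rewrite !(antilinear0 sL); exact: sx.
Qed.

Hypothesis even_stable : forall W, stable W -> ~~ odd (\dim W).

(** The two dimensions are even and differ by at most one. *)
Lemma stable_squeeze U W x : stable U -> stable W -> (U <= W)%VS ->
  (W <= U + <[x]>)%VS -> U = W.
Proof.
move=> /even_stable eU /even_stable eW UW /dimvS WU; apply/eqP;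
  rewrite eqEdim UW /=.
have := leq_trans WU (dim_add_line_le U x); move: eU eW; lia.
Qed.

Lemma stable_line0 W x : stable W -> (W <= <[x]>)%VS -> W = 0%VS.
Proof.
move=> sW Wx; apply/esym/(@stable_squeeze _ _ x) => //;
  rewrite ?sub0v ?add0v //.
by move=> y; rewrite memv0 => /eqP->; rewrite antilinear0 ?mem0v.
Qed.

Lemma stable_plane_abelian W : stable W -> (\dim W <= 2)%N ->
  {in W &, forall x y, lie x y = 0}.
Proof.
move=> sW /plane_span[a [b Wab]] x y Wx Wy.
have W0 := stable_line0 (brk_stable sW sW) (brk_plane Wab).
by apply/eqP; rewrite -memv0 -W0 mem_brk.
Qed.

(** An eigenvector [d] of [s^2] and [s d] span a stable subspace of dimension one or two, and one is
    odd. *)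
Lemma stable_plane_exists W : stable W -> W != 0%VS -> exists d z,
  [/\ d \in W, z != 0, s (s d) = z *: d, \dim (<[d]> + <[s d]>) = 2%N &
      stable (<[d]> + <[s d]>)%VS].
Proof.
move=> sW W0; have [z [d [Wd d0 z0 sd]]] := stable_eigenvector sW W0.
have sU : stable (<[d]> + <[s d]>)%VS.
  move=> x /plane_memP[p [q ->]]; rewrite (antilinearD sL) !(antilinearZ sL) sd.
  by rewrite addrC memv_add // ?memvZ ?memv_line // scalerA memvZ ?memv_line.
exists d, z; split=> //; have := even_stable sU.
have := dim_add_line_le <[d]>%VS (s d); have := dimvS (addvSl <[d]> <[s d]>).
by rewrite dim_vline d0; lia.
Qed.

(** Modulo [[U, V]] the bracket factors through the exterior square of [V / U], spanned by the
    classes of [x] and [y]. *)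
Lemma complement_brk U x y : (fullv = U + (<[x]> + <[y]>))%VS ->
  (brk fullv fullv <= brk U fullv + <[lie x y]>)%VS.
Proof.
move=> UE; apply: brk_sub => a b; rewrite UE.
case/memv_addP=> u Uu [a' /plane_memP[p [q ->]] ->].
case/memv_addP=> u' Uu' [b' /plane_memP[p' [q' ->]] ->].
rewrite lieDl -UE; rewrite [lie (p *: x + q *: y) _]lieDr addrA memv_add //.
  apply: memvD; first by rewrite mem_brk ?memvf.
  by rewrite lieC memvN mem_brk ?memvf.
apply/vlineP; exists (p * q' - q * p').
rewrite !(lieDl, lieDr, lieZl, lieZr) !liexx [lie y x]lieC.
by vring.
Qed.

Hypothesis dimV : (\dim {:V} <= 4)%N.

Let G : {vspace V} := brk fullv fullv.

Lemma derived_stable : stable G.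
Proof. exact: brk_stable stable_full stable_full. Qed.

Lemma derived_plane_central U : stable U -> \dim U = 2%N ->
  {in U & fullv, forall x y, lie x y = 0} -> G = 0%VS.
Proof.
move=> sU dU U0; have [|x [y UE]] := @complement_span _ _ U;
  first by rewrite dU.
apply: (@stable_line0 _ (lie x y)) derived_stable _.
apply: subv_trans (complement_brk UE) _.
suff -> : brk U fullv = 0%VS by rewrite add0v.
apply/eqP; rewrite -subv0; apply: brk_sub => a b Ua _.
by rewrite U0 ?memvf ?mem0v.
Qed.

(** For a stable abelian plane [U] spanned by [d] and [s d], squeezing gives [[U, V] = G], which
    lies in the sum of the images of [ad d] and [ad (s d)], each of dimension at most two. If
    [dim G = 4], these images are complementary planes; the two operators commute, so their product
    vanishes, and each has kernel [U]. Then [G] lies in [U], a contradiction. *)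
Lemma derived_not_full : G != 0%VS -> \dim G = 2%N.
Proof.
move=> G0; have [|d [z [_ _ _ dU sU]]] := stable_plane_exists stable_full.
  by apply: contraNneq G0 => V0; rewrite -subv0 -V0 subvf.
set U := (<[d]> + <[s d]>)%VS in dU sU.
have [|x [y UE]] := @complement_span _ _ U; first by rewrite dU.
pose H := brk U fullv; have sH : stable H := brk_stable sU stable_full.
have GH : H = G.
  apply: stable_squeeze sH derived_stable _ (complement_brk UE).
  by apply: brk_sub => a b _ _; rewrite mem_brk ?memvf.
have U0 := stable_plane_abelian sU (eq_leq dU).
have [Ud Ue] : d \in U /\ s d \in U.
  by split; [apply: (subvP (addvSl _ _)) | apply: (subvP (addvSr _ _))];
    exact: memv_line.
pose im e := (<[lie e x]> + <[lie e y]>)%VS.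
have im_mem e t : e \in U -> lie e t \in im e.
  move=> eU; have : t \in fullv by exact: memvf.
  rewrite UE => /memv_addP[u Uu [t' /plane_memP[p [q ->]] ->]].
  by rewrite lieDr U0 // add0r lieDr !lieZr memv_add // memvZ ?memv_line.
have Him : (H <= im d + im (s d))%VS.
  apply: brk_sub => a b /plane_memP[p [q ->]] _.
  by rewrite lieDl !lieZl memv_add // memvZ // im_mem.
have im_dim e : (\dim (im e) <= 2)%N.
  have := dim_add_line_le <[lie e x]>%VS (lie e y).
  by have := dim_line_le (lie e x); rewrite -/(im e); lia.
have := even_stable sH; have := dimvS Him; have := dimvS (subvf H).
have := im_dim d; have := im_dim (s d); have := dimv_sum_cap (im d) (im (s d)).
have : \dim H != 0 by rewrite dimv_eq0 GH.
rewrite -GH; case: (eqVneq (\dim H) 4); last by lia.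
move=> dH _ cap ims imd _ dHle _.
have [dimd dims dcap] : [/\ \dim (im d) = 2, \dim (im (s d)) = 2 &
    \dim (im d :&: im (s d)) = 0]%N.
  have arith (a b k l h : nat) : (a + b = k + l)%N -> (k <= 2)%N -> (l <= 2)%N
    ->
    h = 4%N -> (h <= a)%N -> [/\ k = 2, l = 2 & b = 0]%N by move=> *; split;
      lia.
  exact: arith cap imd ims dH dHle.
have {dcap} cap0 : (im d :&: im (s d))%VS = 0%VS by apply/eqP;
  rewrite -dimv_eq0 dcap.
have comm t : lie d (lie (s d) t) = lie (s d) (lie d t).
  by apply/eqP; rewrite -subr_eq0 -lie_lie (U0 d (s d)) // lie0l.
have comm0 t : lie d (lie (s d) t) = 0.
  by apply/eqP; rewrite -memv0 -cap0 memv_cap im_mem // comm im_mem.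
have ker e t : e \in U -> \dim (im e) = 2%N -> lie e t = 0 -> t \in U.
  move=> eU dim_e; have : t \in fullv by exact: memvf.
  rewrite UE => /memv_addP[u Uu [t' /plane_memP[p [q ->]] ->]].
  rewrite lieDr U0 // add0r lieDr !lieZr => /(plane_indep dim_e)[-> ->].
  by rewrite !scale0r !addr0.
have : (H <= U)%VS.
  apply: brk_sub => a t /plane_memP[p [q ->]] _.
  rewrite lieDl !lieZl memvD // memvZ //.
    by apply: (ker (s d)); rewrite // -comm comm0.
  by apply: (ker d); rewrite // comm0.
by move/dimvS; rewrite dH dU.
Qed.

Lemma stable_hyperplane (W : {vspace V}) : stable W ->
  (\dim {:V} <= (\dim W).+1)%N -> W = fullv.
Proof.
move=> sW dW; apply/eqP; rewrite eqEdim subvf /=.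
have := even_stable sW; have := even_stable stable_full; move: dW; lia.
Qed.

(** Commuting traceless operators on a plane are proportional, so a nonzero combination of [x] and
    [y] would centralize [D], whereas [D] is its own centralizer. *)
Lemma derived_not_plane : \dim G <> 2%N.
Proof.
move=> dG; have G0 : G != 0%VS by rewrite -dimv_eq0 dG.
have [d [z [Gd z0 sd dD sD]]] := stable_plane_exists derived_stable G0.
set D := (<[d]> + <[s d]>)%VS in dD sD.
have GD : G = D.
  apply/esym/eqP; rewrite eqEdim dD dG leqnn andbT.
  apply/subvP => _ /plane_memP[p [q ->]].
  by rewrite memvD // memvZ //; exact: derived_stable.
have lieG a b : lie a b \in D by rewrite -GD mem_brk ?memvf.
have [Dd De] : d \in D /\ s d \in D.
  by split; [apply: (subvP (addvSl _ _)) | apply: (subvP (addvSr _ _))];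
    exact: memv_line.
have D0 := stable_plane_abelian sD (eq_leq dD).
pose e := [tuple d; s d]; pose i0 : 'I_2 := ord0;
  pose i1 : 'I_2 := lift ord0 ord0.
have be : basis_of D e.
  suff: basis_of D [:: d; s d] by [].
  by rewrite basisEdim dD span_cons span_seq1 subvv.
have eE x : x \in D -> x = coord e i0 x *: d + coord e i1 x *: s d.
  by move=> Dx; rewrite {1}(coord_basis be Dx) big_ord_recl big_ord1.
have ind p q p' q' : p *: d + q *: s d = p' *: d + q' *: s d -> p = p' /\ q =
  q'.
  move=> pq; have : (p - p') *: d + (q - q') *: s d = 0.
    by rewrite -(subrr (p *: d + q *: s d)) {2}pq; vring.
  by case/(plane_indep dD) => /eqP + /eqP; rewrite !subr_eq0 => /eqP-> /eqP->.
have cE p q : coord e i0 (p *: d + q *: s d) = p /\ coord e i1 (p *: d + q *: s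
  d) = q.
  have Dpq : p *: d + q *: s d \in D by rewrite memvD // memvZ.
  by have [pE qE] := ind _ _ _ _ (eE _ Dpq); split; apply: esym.
pose tr x := coord e i0 (lie x d) + coord e i1 (lie x (s d)).
have trL : linear (tr : V -> C^o).
  by move=> a x y; rewrite /tr !lieDl !lieZl !linearP /= scalerDr addrACA.
(* On [D], [s] intertwines [ad x] and [ad (s x)] antilinearly, so their traces are conjugate. The
   kernel of the trace is then stable of codimension at most one, hence everything. *)
have tr_s x : tr (s x) = (tr x)^*%C.
  have := eE _ (lieG x d); have := eE _ (lieG x (s d)); rewrite /tr.
  move: (coord e i0 _) (coord e i1 _) => r t xd1;
    move: (coord e i0 _) (coord e i1 _) => p q xd.
  have := congr1 s xd; have := congr1 s xd1.
  rewrite !(antilinearD sL) !(antilinearZ sL) !s_lie !sd lieZr !scalerA =>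
    xs1 xs.
  have -> : lie (s x) (s d) = (q^*%C * z) *: d + p^*%C *: s d by rewrite xs
    addrC.
  have -> : lie (s x) d = (t^*%C) *: d + (z^-1 * r^*%C) *: s d.
    rewrite -[LHS](scalerK z0) xs1 scalerDr !scalerA addrC.
    by rewrite mulrCA mulVf // mulr1.
  by rewrite (cE _ _).1 (cE _ _).2 rmorphD addrC.
pose trM := GRing.isLinear.Build C V C^o _ tr trL.
pose trF : {linear V -> C^o} := HB.pack (tr : V -> C^o) trM.
pose T := lker (linfun trF).
have memT x : (x \in T) = (tr x == 0) by rewrite memv_ker lfunE.
have TV : T = fullv.
  apply: stable_hyperplane => [x|].
    by rewrite !memT tr_s => /eqP->; rewrite conjc0.
  have := limg_ker_dim (linfun trF) fullv; rewrite capfv -/T => <-.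
  by rewrite -addn1 leq_add2l (leq_trans (dimvS (subvf _))) // dimvf.
have tr0 x : tr x = 0 by apply/eqP; rewrite -memT TV memvf.
have act x : exists p q r, lie x d = p *: d + q *: s d /\
    lie x (s d) = r *: d + (- p) *: s d.
  have := tr0 x; rewrite /tr => /eqP; rewrite addrC addr_eq0 => /eqP pE.
  exists (coord e i0 (lie x d)), (coord e i1 (lie x d)), (coord e i0 (lie x (s
    d))).
  by rewrite -pE; split; exact: eE.
have comm x y t : t \in D -> lie x (lie y t) = lie y (lie x t).
  by move=> Dt; apply/eqP; rewrite -subr_eq0 -lie_lie D0.
have cent_notin x : lie x d = 0 -> lie x (s d) = 0 -> x \in D.
  move=> xd xsd; pose Z := (lker (linfun (lie d)) :&: lker (linfun (lie (s
    d))))%VS.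
  have memZ t : (t \in Z) = (lie d t == 0) && (lie (s d) t == 0).
    by rewrite memv_cap; congr (_ && _); rewrite memv_ker lfunE.
  have sZ : stable Z.
    move=> t; rewrite !memZ => /andP[/eqP dt /eqP sdt].
    rewrite -s_lie dt antilinear0 // eqxx andbT.
    have : z *: lie d (s t) = 0 by rewrite -lieZl -sd -s_lie sdt antilinear0.
    by move/eqP; rewrite scaler_eq0 (negPf z0).
  have DZ : (D <= Z)%VS.
    by apply/subvP => t Dt; rewrite memZ !D0 // eqxx.
  have ZnV : Z != fullv.
    apply: contraNneq G0 => ZV; apply/eqP; apply: (derived_plane_central sD dD).
    move=> a b Da _; have : b \in Z by rewrite ZV memvf.
    rewrite memZ => /andP[/eqP db /eqP sdb].
    by move/plane_memP: Da => [p [q ->]];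
      rewrite lieDl !lieZl db sdb !scaler0 addr0.
  have -> : D = Z.
    apply/eqP; rewrite eqEdim DZ dD /=; have := even_stable sZ.
    have : (\dim Z < \dim {:V})%N.
      by rewrite ltn_neqAle dimvS ?subvf // andbT; apply: contraNneq ZnV => dZ;
        rewrite eqEdim subvf dZ /=.
    have arith (a b : nat) : (a < b)%N -> ~~ odd a -> (b <= 4)%N -> (a <= 2)%N
      by lia.
    by move=> /arith h /h h'; exact: h' dimV.
  by rewrite memZ lieC xd [lie (s d) x]lieC xsd oppr0 eqxx.
have [|x [y VE]] := @complement_span _ _ D; first by rewrite dD.
have DV : D <> fullv.
  move=> DV; move/eqP: G0; apply;
    apply: (derived_plane_central sD dD) => a b Da _.
  by rewrite D0 // DV memvf.
have squeeze t : ~ (fullv <= D + <[t]>)%VS.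
  by move=> Vt; apply: DV; apply: stable_squeeze sD stable_full (subvf _) Vt.
have nocomb a b : a *: x + b *: y \in D -> a = 0 /\ b = 0.
  move=> Dab; split; apply/eqP/negPn/negP => ab0.
    apply: (squeeze y); rewrite {1}VE subv_add addvSl subv_add addvSr andbT /=
      -memvE.
    rewrite -(scalerK ab0 x) memvZ // -(addrK (b *: y) (a *: x)).
    by rewrite memvB ?(subvP (addvSl _ _) _ Dab) // (subvP (addvSr _ _)) //
      memvZ ?memv_line.
  apply: (squeeze x); rewrite {1}VE subv_add addvSl subv_add addvSr /= -memvE.
  rewrite -(scalerK ab0 y) memvZ // -(addrK (a *: x) (b *: y)) [b *: y +
    _]addrC.
  by rewrite memvB ?(subvP (addvSl _ _) _ Dab) // (subvP (addvSr _ _)) // memvZ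
    ?memv_line.
have [p [q [r [xd xsd]]]] := act x; have [p' [q' [r' [yd ysd]]]] := act y.
have := comm x y d Dd; rewrite xd yd !(lieDr, lieZr) xd yd xsd ysd => e1.
have := comm x y (s d) De; rewrite xsd ysd !(lieDr, lieZr) xd yd xsd ysd => e2.
have {}e1 : (p' * p + q' * r) *: d + (p' * q - q' * p) *: s d =
    (p * p' + q * r') *: d + (p * q' - q * p') *: s d.
  transitivity (p' *: (p *: d + q *: s d) + q' *: (r *: d + (- p) *: s d));
    first by vring.
  by rewrite e1; vring.
have {}e2 : (r' * p - p' * r) *: d + (r' * q + p' * p) *: s d =
    (r * p' - p * r') *: d + (r * q' + p * p') *: s d.
  transitivity (r' *: (p *: d + q *: s d) + (- p') *: (r *: d + (- p) *: s d));
    first by vring.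
  by rewrite e2; vring.
have two_eq0 (a : C) : a *+ 2 = 0 -> a = 0 by move/eqP;
  rewrite mulrn_eq0 => /eqP.
have {e1}[qr pq] := ind _ _ _ _ e1; have {e2}[pr _] := ind _ _ _ _ e2.
(* The commutation relations make all minors of [(p, q, r)] and [(p', q', r')] vanish. *)
have {}qr : q' * r = q * r' by apply: (addrI (p' * p)); rewrite qr mulrC.
have {}pq : p' * q = q' * p.
  apply/eqP; rewrite -subr_eq0; apply/eqP/two_eq0.
  by rewrite mulr2n {1}pq; ring.
have {}pr : r' * p = p' * r.
  apply/eqP; rewrite -subr_eq0; apply/eqP/two_eq0.
  by rewrite mulr2n {1}pr; ring.
have comb a b : a * p + b * p' = 0 -> a * q + b * q' = 0 -> a * r + b * r' = 0
  ->
    a = 0 /\ b = 0.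
  move=> pE qE rE; apply: nocomb; apply: cent_notin; rewrite lieDl !lieZl.
    transitivity ((a * p + b * p') *: d + (a * q + b * q') *: s d).
      by rewrite xd yd; vring.
    by rewrite pE qE !scale0r addr0.
  transitivity ((a * r + b * r') *: d + (- (a * p + b * p')) *: s d).
    by rewrite xsd ysd; vring.
  by rewrite pE rE oppr0 !scale0r addr0.
(* The coefficients [- p'] and [p] give a relation between the two matrices by the vanishing minors,
   so both are zero; likewise for [q] and [r]. *)
have p0 : p = 0.
  apply: (comb (- p') p _ _ _).2; first by ring.
    by rewrite mulNr pq; ring.
  by rewrite mulNr -pr; ring.
have q0 : q = 0.
  apply: (comb (- q') q _ _ _).2; last by rewrite mulNr qr; ring.
    by rewrite mulNr -pq; ring.
  by ring.
have r0 : r = 0.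
  apply: (comb (- r') r _ _ _).2; last by ring.
    by rewrite mulNr pr; ring.
  by rewrite mulNr [r * q']mulrC qr; ring.
have [/eqP + _] : (1 : C) = 0 /\ (0 : C) = 0.
  by apply: comb; rewrite ?p0 ?q0 ?r0 mul0r mulr0 addr0.
by rewrite oner_eq0.
Qed.

Lemma no_odd_abelian x y : lie x y = 0.
Proof.
have [G0 | /derived_not_full/derived_not_plane //] := eqVneq G 0%VS.
by apply/eqP; rewrite -memv0 -G0 mem_brk ?memvf.
Qed.

End NoOddSubspace.

(** * Abelian algebras and the parity of quaternionic subspaces *)

Lemma abelian_real_structure (R : rcfType) (V : vectLieAlgType R[i]) :
  (forall x y : V, lie x y = 0) -> inhabited (real_structure V).
Proof.
move=> ab; apply: (real_structure_of_basis (vbasisP fullv)).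
have span0 (X : seq V) : real_span X 0.
  by elim: X => [|x X IH] //=; exists 0; rewrite rmorph0 scale0r subr0.
suff all_real X X' : real_brackets (V := V) X X' by exact: all_real.
by elim: X' => [|x X' IH] //=; split=> // y _; rewrite ab; exact: span0.
Qed.

(** A stable subspace [U] grows two dimensions at a time: if [v] is not in [U] but [s v = u + a v]
    with [u] in [U], applying [s] again puts [1 + |a|^2] times [v] in [U]. *)
Lemma quaternionic_even (R : rcfType) (V : vectType R[i]) (s : V -> V)
    (W : {vspace V}) : antilinear s ->
  (forall x, x \in W -> s x \in W) -> (forall x, x \in W -> s (s x) = - x) ->
  ~~ odd (\dim W).
Proof.
move=> sL sW sK.
suff: forall n (U : {vspace V}), (U <= W)%VS -> (forall x, x \in U -> s x \in
  U) ->
    ~~ odd (\dim U) -> (\dim W - \dim U <= n)%N -> ~~ odd (\dim W).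
  move/(_ (\dim W) 0%VS); apply; rewrite ?sub0v ?dimv0 ?leq_subr //.
  by move=> x; rewrite memv0 => /eqP->; rewrite antilinear0 ?mem0v.
elim=> [|n IHn] U UW sU eU dUW.
  suff -> : W = U by [].
  by apply/esym/eqP; rewrite eqEdim UW -subn_eq0 -leqn0.
have [WU | /subvPn[v Wv Uv]] := boolP (W <= U)%VS.
  by have -> : W = U by apply/eqP; rewrite eqEsubv WU.
have ssv := sK _ Wv.
have sv_notin : s v \notin (U + <[v]>)%VS.
  apply/negP => /memv_addP[u Uu [_ /vlineP[a ->] svE]].
  have : (1 + a * a^*%C) *: v \in U.
    have := ssv; rewrite {1}svE antilinearD // antilinearZ // svE => vE.
    have -> : (1 + a * a^*%C) *: v = - (s u + a^*%C *: u).
      by rewrite scalerDl scale1r -[v in v + _]opprK -vE; vring.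
    by rewrite memvN memvD ?sU // memvZ.
  have a0 : 1 + a * a^*%C != 0 by rewrite gt_eqF // ltr_pwDl // mulcJ_ge0.
  by move/(memvZ (1 + a * a^*%C)^-1); rewrite scalerK //; apply/negP.
have dU2 : \dim (U + <[v]> + <[s v]>) = (\dim U).+2.
  by rewrite dim_add_line // dim_add_line.
apply: (IHn (U + <[v]> + <[s v]>)%VS).
- by rewrite !subv_add UW -!memvE Wv sW.
- move=> x /memv_addP[_ /memv_addP[u Uu [_ /vlineP[a ->] ->]] [_ /vlineP[b ->]
  ->]].
  rewrite !(antilinearD sL) !(antilinearZ sL) ssv.
  rewrite (_ : _ + _ = s u + (- b^*%C) *: v + a^*%C *: s v); last by vring.
  by rewrite memv_add ?memvZ ?memv_line // memv_add ?memvZ ?memv_line ?sU.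
- by rewrite dU2 /= negbK.
- by rewrite dU2; lia.
Qed.

(** * Dimension at most four *)

Section Main.
Variables (R : rcfType) (V : vectLieAlgType R[i]) (s : V -> V).
Local Notation C := R[i].
Hypotheses (sL : antilinear s) (s_lie : lie_morph s) (s_inj : injective s)
  (dimV : (\dim {:V} <= 4)%N).

Lemma real_structure_of_antilinear : inhabited (real_structure V).
Proof.
have [s0 [s0L s04 s_s0 s_eps [gpp gpm s0_lie]]] := normalize sL s_lie s_inj.
pose eps x := s0 (s0 x).
have epsL : linear eps by move=> a x y; rewrite /eps !s0L conjcK.
pose epsM := GRing.isLinear.Build C V V _ eps epsL.
pose epsF : {linear V -> V} := HB.pack eps epsM.
have [Vp memVp] : exists Vp : {vspace V}, forall x, (x \in Vp) = (s0 (s0 x) ==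
  x).
  exists (lker (linfun epsF - \1)%VF) => x.
  by rewrite memv_ker add_lfunE opp_lfunE lfunE id_lfunE subr_eq0.
have [Vm memVm] : exists Vm : {vspace V}, forall x, (x \in Vm) = (s0 (s0 x) ==
  - x).
  exists (lker (linfun epsF + \1)%VF) => x.
  by rewrite memv_ker add_lfunE lfunE id_lfunE addr_eq0.
have VmK x : x \in Vm -> s0 (s0 x) = - x by rewrite memVm => /eqP.
have capV : (Vp :&: Vm = 0)%VS.
  apply/eqP; rewrite -subv0; apply/subvP => x.
  rewrite memv_cap memVp memVm memv0 => /andP[/eqP-> /eqP xx].
  by rewrite -[x]half_double {2}xx subrr scaler0.
have addV : (Vp + Vm = fullv)%VS.
  apply/eqP; rewrite eqEsubv subvf; apply/subvP => x _.
  rewrite (half_sum_diff x (s0 (s0 x))) memv_add ?memvZ //.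
    by rewrite memVp !(antilinearD s0L) s04 addrC.
  by rewrite memVm !(antilinearB s0L) s04 opprB.
have dimpm : (\dim Vp + \dim Vm <= 4)%N by rewrite -dimv_disjoint_sum // addV.
have sVm : stable s Vm.
  by move=> x; rewrite !memVm -s_eps => /eqP->; rewrite (antilinearN sL).
have eVm : ~~ odd (\dim Vm) := quaternionic_even s0L (s_s0 _ sVm) VmK.
have : (\dim Vm = 0 \/ \dim Vm = 2 \/ \dim Vm = 4)%N by move: dimpm eVm; lia.
case=> [Vm0 | [Vm2 | Vm4]].
- have {}Vm0 : Vm = 0%VS by apply/eqP; rewrite -dimv_eq0 Vm0.
  have s0K : involutive s0.
    by move=> x; apply/eqP; rewrite -memVp; move: (memvf x);
      rewrite -addV Vm0 addv0.
  have s0l : lie_morph s0 by apply: s0_lie => x y _ _; rewrite s0K.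
  exact: inhabits (RealStructure s0L s0l s0K).
- have [|a [b VmE]] := @plane_span _ _ Vm; first by rewrite Vm2.
  have brV : (brk Vm Vm <= <[lie a b]>)%VS := brk_plane VmE.
  (* [[Vm, Vm]] is at most a line, stable under the automorphism [s] and hence under [s0]. On it
     [s0^2] acts by some [|k|^2], which squares to one, so it is one and [[Vm, Vm]] lies in [Vp]. *)
  have c_eps : s0 (s0 (lie a b)) = lie a b.
    have sb : stable s (brk Vm Vm) := brk_stable sL s_lie sVm sVm.
    have [Va Vb] : a \in Vm /\ b \in Vm.
      rewrite VmE; split; [apply: (subvP (addvSl _ _)) | apply: (subvP (addvSr
        _ _))];
      exact: memv_line.
    have : s0 (lie a b) \in brk Vm Vm by apply: s_s0 => //; rewrite mem_brk.
    move/(subvP brV)/vlineP=> [k s0c].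
    have [-> | c0] := eqVneq (lie a b) 0; first by rewrite !(antilinear0 s0L).
    pose m := k^*%C * k; have epsc : s0 (s0 (lie a b)) = m *: lie a b.
      by rewrite s0c (antilinearZ s0L) s0c scalerA.
    have : (m ^+ 2 - 1) *: lie a b = 0.
      rewrite scalerBl scale1r -[X in _ - X]s04 epsc !(antilinearZ s0L) epsc
        scalerA.
      by rewrite conjcK expr2 subrr.
    move/eqP; rewrite scaler_eq0 (negPf c0) orbF subr_eq0 sqrf_eq1 =>
      /orP[] /eqP mE.
      by rewrite epsc mE scale1r.
    by have := mulcJ_ge0 k; rewrite mulrC -/m mE oppr_ge0 ler10.
  have s0l : lie_morph s0.
    apply: s0_lie => x y xm ym.
    have : lie x y \in brk Vm Vm by rewrite mem_brk ?memVm ?xm ?ym.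
    move/(subvP brV)/vlineP=> [k ->].
    by rewrite !(antilinearZ s0L) c_eps conjcK.
  apply: (quaternionic_real_structure s0L s0l s04 memVp memVm _ Vm2).
  by move: dimpm; rewrite Vm2; lia.
have VmV : Vm = fullv by apply/eqP; rewrite eqEdim subvf Vm4.
(* Now [s0^2 = -1] everywhere, and [s]-stable subspaces are [s0]-stable, so they all have even
   dimension. *)
apply: abelian_real_structure;
  apply: (no_odd_abelian sL s_lie s_inj _ dimV) => W sW.
apply: (quaternionic_even s0L (s_s0 _ sW)) => x _.
by apply: VmK; rewrite VmV memvf.
Qed.

End Main.

Theorem proposition5p8 (R : realType) (g : vectLieAlgType R[i])
    (dim_g : (\dim {:g} <= 4)%N) :
  defined_over_reals g <-> lie_isomorphic g (conj_lie g).
Proof.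
split=> [|/antilinear_aut_of_iso[s [sL s_lie s_inj]]]; first exact: conj_iso_of_defined.
have [s0] := real_structure_of_antilinear sL s_lie s_inj dim_g.
exact: defined_over_reals_of s0.
Qed.
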